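(* Assume that $P_T$ (or $P$) exists. Suppose that $$\dot x(t)=Ax(t)+Bu(t)+N(\mathfrak u(t)\otimes x(t))+H(x(t)\otimes x(t)),\quad x(0)=0,$$ has a (unique) global solution $x$ on $[0,T]$, and let $y(t)=Cx(t)$. Let $V=[p_1\ \dots\ p_{\hat n}]$, where $p_1,\dots,p_{\hat n}$ ($\hat n\le n$) are all orthonormal eigenvectors of $P_T$ (or of $P$, respectively) associated with all non-zero eigenvalues. Then $x(t)=V\hat x(t)$ for $t\in[0,T]$, where $\hat x(t)=[\langle x(t),p_1\rangle\ \dots\ \langle x(t),p_{\hat n}\rangle]^\top\in\mathbb R^{\hat n}$ satisfies $$\dot{\hat x}(t)=\hat A\hat x(t)+\hat Bu(t)+\hat N(\mathfrak u(t)\otimes\hat x(t))+\hat H(\hat x(t)\otimes\hat x(t)),\quad\hat x(0)=0,$$ $$y(t)=\hat C\hat x(t),\quad t\in[0,T],$$ with the same output $y$ as the original system, where $$\hat A=V^\top AV,\quad\hat B=V^\top B,\quad\hat N=V^\top N(I\otimes V),\quad\hat H=V^\top H(V\otimes V),\quad\hat C=CV.$$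
   Context: Setting: $n,m,p\in\mathbb N$, $T>0$, $A\in\mathbb R^{n\times n}$, $B\in\mathbb R^{n\times m}$, $C\in\mathbb R^{p\times n}$, $N=[N_1\ \dots\ N_m]$, $H=[H_1\ \dots\ H_n]$ with $N_k,H_j\in\mathbb R^{n\times n}$; the controls $u,\mathfrak u:[0,T]\to\mathbb R^m$ are square integrable; $\otimes$ is the Kronecker product; $\langle\cdot,\cdot\rangle$ is the Euclidean inner product. Differential equations are understood in integrated form. Gramians: $\mathcal L(X)=AX+XA^\top+N(I\otimes X)N^\top$. $Z_{1,T}$ solves $\dot Z_{1,T}=\mathcal L(Z_{1,T})$ on $[0,\infty)$, $Z_{1,T}(0)=BB^\top$, and for $i\ge2$, $\dot Z_{i,T}=\mathcal L(Z_{i,T})$, $Z_{i,T}(0)=H\big(\sum_{k=1}^{i-1}\int_0^TZ_{k,T}(s)\,\mathrm ds\otimes\int_0^TZ_{i-k,T}(s)\,\mathrm ds\big)H^\top$. $Z_{i,\infty}$ is defined in the same way with $T$ replaced by $\infty$ in the initial values. $P_T:=\sum_{i=1}^\infty\int_0^TZ_{i,T}(s)\,\mathrm ds$, $P:=\sum_{i=1}^\infty\int_0^\infty Z_{i,\infty}(s)\,\mathrm ds$; a Gramian ''exists'' if the series (and, for $P$, all improper integrals) converge. Both are symmetric positive semidefinite. *)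

(* Defs.v *)
From HB Require Import structures.
From mathcomp Require Import all_boot all_order all_algebra.
From mathcomp Require Import all_classical all_reals all_analysis.
From mathcomp Require Export mxtens.

Set Implicit Arguments.
Unset Strict Implicit.
Unset Printing Implicit Defensive.

Import Order.TTheory GRing.Theory Num.Theory.
Import numFieldNormedType.Exports.

Local Open Scope classical_set_scope.
Local Open Scope ring_scope.

(* [A *t B] is the Kronecker product (mxtens). A block row [N_1 ... N_m] of
   [n] x [n] matrices is an element of ['M_(n, m * n)]: column [k * n + j] is
   column [j] of the block with (zero-based) number [k], which is the ordering
   used by [*t], so that [N *m (v *t x)] is the sum of the [v_k N_k x]. *)

Section MatrixIntegral.
Variables (R : realType) (k l : nat).
Implicit Types (D : set R) (F : R -> 'M[R]_(k, l)).

Definition mx_integrable D F : Prop :=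
  forall i j, (@lebesgue_measure R).-integrable D (fun s => (F s i j)%:E).

Definition mx_integral D F : 'M[R]_(k, l) :=
  \matrix_(i, j) (\int[@lebesgue_measure R]_(s in D) F s i j).

(* [x] solves x' = f(t, x), x(0) = x0 at all times in [D] (an interval with left
   end 0), in integrated form. Integrability of the right-hand side is part of
   the notion, because the library's integral also has a value for
   non-integrable functions. At t = 0 the equation reads x(0) = x0. *)
Definition solves_on D (f : R -> 'M[R]_(k, l) -> 'M[R]_(k, l))
    (x0 : 'M[R]_(k, l)) (x : R -> 'M[R]_(k, l)) : Prop :=
  forall t, D t ->
    mx_integrable `[0, t] (fun s => f s (x s)) /\
    x t = x0 + mx_integral `[0, t] (fun s => f s (x s)).

Definition square_integrable_on D F : Prop :=
  forall i j, measurable_fun D (fun s => F s i j) /\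
    (@lebesgue_measure R).-integrable D (fun s => (F s i j ^+ 2)%:E).

End MatrixIntegral.

Section Gramians.
Variables (R : realType) (n m : nat).
Variables (A : 'M[R]_n) (B : 'M[R]_(n, m)).
Variables (N : 'M[R]_(n, m * n)) (H : 'M[R]_(n, n * n)).

Definition lyap (X : 'M[R]_n) : 'M[R]_n :=
  A *m X + X *m A^T + N *m ((1%:M : 'M[R]_m) *t X) *m N^T.

(* Initial value of the i-th term (i >= 1) when [G k] is the integral of the
   k-th term. *)
Definition gramian_init (G : nat -> 'M[R]_n) (i : nat) : 'M[R]_n :=
  if i == 1%N then B *m B^T
  else H *m (\sum_(1 <= k < i) (G k *t G (i - k)%N)) *m H^T.

(* [Z] is indexed from 1 and [Z 0] is ignored, as is [G 0]. *)
Definition gramian_terms (G : nat -> 'M[R]_n) (Z : nat -> R -> 'M[R]_n) : Prop :=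
  forall i, (1 <= i)%N ->
    solves_on `[0, +oo[ (fun=> lyap) (gramian_init G i) (Z i).

(* The Gramian P_T exists and is equal to [P]. *)
Definition is_gramian_finite (T : R) (P : 'M[R]_n) : Prop :=
  exists Z : nat -> R -> 'M[R]_n,
    let G i := mx_integral `[0, T] (Z i) in
    gramian_terms G Z /\
    (fun r => \sum_(1 <= i < r) G i) @ \oo --> P.

(* The infinite-time Gramian exists and is equal to [P]; [G i] is the improper
   integral of [Z i] over [0, +oo[. *)
Definition is_gramian_infinite (P : 'M[R]_n) : Prop :=
  exists (Z : nat -> R -> 'M[R]_n) (G : nat -> 'M[R]_n),
    [/\ gramian_terms G Z,
        forall i, (1 <= i)%N -> mx_integral `[0, t] (Z i) @[t --> +oo] --> G i
      & (fun r => \sum_(1 <= i < r) G i) @ \oo --> P].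

End Gramians.

Section Vectors.
Variables (R : realType) (n : nat).

Definition dotv (x y : 'cV[R]_n) : R := \sum_k x k 0 * y k 0.

Definition mx_of_cols r (p : 'I_r -> 'cV[R]_n) : 'M[R]_(n, r) :=
  \matrix_(k, i) p i k 0.

(* [p] lists all orthonormal eigenvectors associated with the non-zero
   eigenvalues of [P]: an orthonormal family of such eigenvectors in whose span
   every such eigenvector lies. Eigenvectors are columns here, whereas
   [eigenspace] is about rows. *)
Definition orthonormal_eigenvectors r (P : 'M[R]_n) (p : 'I_r -> 'cV[R]_n) :
    Prop :=
  [/\ forall i j, dotv (p i) (p j) = (i == j)%:R,
      forall i, exists2 a : R, a != 0 & P *m p i = a *: p i
    & forall (q : 'cV[R]_n) (a : R), a != 0 -> P *m q = a *: q ->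
        exists c : 'I_r -> R, q = \sum_i c i *: p i].

End Vectors.

Definition system_rhs (R : realType) (n m : nat)
    (A : 'M[R]_n) (B : 'M[R]_(n, m)) (N : 'M[R]_(n, m * n))
    (H : 'M[R]_(n, n * n)) (u v : R -> 'cV[R]_m) (t : R) (x : 'cV[R]_n) :
    'cV[R]_n :=
  A *m x + B *m u t + N *m (v t *t x) + H *m (x *t x).

(* Main.v *)
Require Import Defs.
From HB Require Import structures.
From mathcomp Require Import all_boot all_order all_algebra.
From mathcomp Require Import all_classical all_reals all_analysis.
From mathcomp Require Import measurable_realfun complex spectral ring lra.

Set Implicit Arguments.
Unset Strict Implicit.
Unset Printing Implicit Defensive.

Import Order.TTheory GRing.Theory Num.Theory.
Import numFieldNormedType.Exports.

Local Open Scope classical_set_scope.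
Local Open Scope ring_scope.

(** The columns of V span the range of P, so the claim x = V xh says that the
    trajectory stays in the range of P. This holds because that range is
    invariant under every part of the dynamics, and the reduced equation is then
    the original one written in the coordinates V^T x.

    Invariance is proved on the orthogonal complement, the kernel of P. Each
    matrix Z_i(s) is symmetric positive semidefinite (lyap_solution_psd): one
    explicit Euler step of the Lyapunov equation is, up to an error of second
    order, the congruence-type map euler_step, which preserves positivity. The
    initial values are positive as well, because a Kronecker product of positive
    semidefinite matrices is positive semidefinite (psd_tens). Since P is a sum
    of integrals of positive matrices, P z = 0 forces Z_i(s) z = 0 for all i and
    all times s under the integral (kernel_killed). Three consequences follow.
    Differentiating Z_i(s) z = 0 in s gives L(Z_i(s)) z = 0, where L is the
    Lyapunov operator (killed_lyap); pairing this with z isolates the positive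
    term of L, whence (I (x) Z_i(s)) N^T z = 0, and then Z_i(s) A^T z = 0. The
    initial value of Z_1 gives B^T z = 0. The initial value of Z_(k+l) contains
    the positive term H (G_k (x) G_l) H^T, so that (G_k (x) G_l) H^T z = 0 for
    all k and l. Summing up, A^T, N^T and H^T map ker P into the kernels of P,
    I (x) P and P (x) P (invariant_kernel). The finite and the infinite Gramian
    are treated together through faithful_average, the only property of the
    passage from Z_i to its integral that the argument uses.

    Let Q = 1 - V V^T. By the spectral theorem P Q = 0 (cols_kernel), so the
    transposed statements say that Q annihilates B and the images under A, N and
    H of the range of V. Therefore Q x solves an equation whose right-hand side
    is bounded by g(s) |Q x(s)|, with g integrable because x is bounded and the
    bilinear control is integrable. Gronwall's lemma gives Q x = 0
    (solution_in_range). *)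

(** * Positive semidefinite matrices *)

Section PSD.
Variable R : rcfType.

Definition bform n (S : 'M[R]_n) (z w : 'cV[R]_n) : R := (z^T *m S *m w) 0 0.

Definition psd n (S : 'M[R]_n) : Prop :=
  S^T = S /\ forall z, 0 <= bform S z z.

Lemma bformC n (S : 'M[R]_n) z w : S^T = S -> bform S z w = bform S w z.
Proof.
move=> Ssym; rewrite /bform.
have -> : w^T *m S *m z = (z^T *m S *m w)^T by rewrite !trmx_mul trmxK Ssym mulmxA.
by rewrite [RHS]mxE.
Qed.

Lemma bformDr n (S : 'M[R]_n) z w w' :
  bform S z (w + w') = bform S z w + bform S z w'.
Proof. by rewrite /bform mulmxDr mxE. Qed.

Lemma bformZr n (S : 'M[R]_n) z w a : bform S z (a *: w) = a * bform S z w.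
Proof. by rewrite /bform -scalemxAr mxE. Qed.

Lemma bformDm n (S S' : 'M[R]_n) z w :
  bform (S + S') z w = bform S z w + bform S' z w.
Proof. by rewrite /bform mulmxDr mulmxDl mxE. Qed.

Lemma bformZm n (S : 'M[R]_n) z w a : bform (a *: S) z w = a * bform S z w.
Proof. by rewrite /bform -scalemxAr -scalemxAl mxE. Qed.

Lemma bformBm n (S S' : 'M[R]_n) z w :
  bform (S - S') z w = bform S z w - bform S' z w.
Proof. by rewrite bformDm -scaleN1r bformZm mulN1r. Qed.

Lemma bform_congr n k (F : 'M[R]_(n, k)) S z w :
  bform (F *m S *m F^T) z w = bform S (F^T *m z) (F^T *m w).
Proof. by rewrite /bform trmx_mul trmxK !mulmxA. Qed.

Lemma sqnorm_ge0 n (z : 'cV[R]_n) : 0 <= (z^T *m z) 0 0.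
Proof. by rewrite mxE sumr_ge0 // => i _; rewrite mxE -expr2 sqr_ge0. Qed.

Lemma sqnorm_eq0 n (z : 'cV[R]_n) : (z^T *m z) 0 0 = 0 -> z = 0.
Proof.
rewrite mxE => /eqP; rewrite psumr_eq0 => [|i _]; last by rewrite mxE -expr2 sqr_ge0.
move=> /allP z0; apply/colP => i; rewrite mxE; apply/eqP.
by have := z0 i; rewrite mem_index_enum mxE -expr2 sqrf_eq0; apply.
Qed.

(** The quadratic polynomial t |-> bform S (z + t w) (z + t w) is nonnegative, so
    it takes a nonnegative value at its vertex. *)
Lemma psd_cauchy_schwarz n (S : 'M[R]_n) z w : psd S ->
  bform S z w ^+ 2 <= bform S z z * bform S w w.
Proof.
move=> [Ssym Sge].
have q t : 0 <= bform S z z + 2 * t * bform S z w + t ^+ 2 * bform S w w.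
  have := Sge (z + t *: w); rewrite !bformDr !bformZr.
  rewrite (bformC _ z) // (bformC _ w) // !bformDr !bformZr (bformC w z) //.
  by move/le_trans; apply; rewrite le_eqVlt; apply/orP; left; apply/eqP; ring.
have := Sge z; have := Sge w; move: q.
set a := bform S z z; set b := bform S z w; set c := bform S w w => q c0 a0.
have [c0'|cn0] := eqVneq c 0.
  have [->|b0] := eqVneq b 0; first by rewrite expr0n /= mulr_ge0.
  (* With c = 0 the polynomial is affine; at this t it equals -1. *)
  have := q (- (a + 1) / (2 * b)); rewrite c0' mulr0 addr0.
  have -> : 2 * (- (a + 1) / (2 * b)) * b = - (a + 1) by field.
  by lra.
have := q (- b / c).
have -> : a + 2 * (- b / c) * b + (- b / c) ^+ 2 * c = (a * c - b ^+ 2) / c.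
  by field.
by rewrite pmulr_lge0 ?subr_ge0 // invr_gt0 lt_def cn0.
Qed.

(** Cauchy-Schwarz for the pair z, S z bounds |S z|^2 by 0. *)
Lemma psd_ker n (S : 'M[R]_n) z : psd S -> bform S z z = 0 -> S *m z = 0.
Proof.
move=> Spsd z0; have [Ssym _] := Spsd.
have := psd_cauchy_schwarz z (S *m z) Spsd; rewrite z0 mul0r => h.
apply: sqnorm_eq0; apply/eqP; rewrite -sqrf_eq0 eq_le sqr_ge0 andbT.
by move: h; rewrite /bform trmx_mul Ssym -!mulmxA.
Qed.

Lemma psd_congr n k (F : 'M[R]_(n, k)) S : psd S -> psd (F *m S *m F^T).
Proof.
move=> [Ssym Sge]; split; first by rewrite !trmx_mul trmxK Ssym mulmxA.
by move=> z; rewrite bform_congr.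
Qed.

Lemma psd_gram n k (F : 'M[R]_(n, k)) : psd (F *m F^T).
Proof.
rewrite -[F in F *m _]mulmx1; apply: psd_congr; split; first exact: trmx1.
by move=> z; rewrite /bform mulmx1 sqnorm_ge0.
Qed.

Lemma psd0 n : psd (0 : 'M[R]_n).
Proof. by split=> [|z]; rewrite ?trmx0 // /bform mulmx0 mul0mx mxE. Qed.

Lemma psdD n (S S' : 'M[R]_n) : psd S -> psd S' -> psd (S + S').
Proof.
move=> [Ssym Sge] [S'sym S'ge]; split; first by rewrite raddfD /= Ssym S'sym.
by move=> z; rewrite bformDm addr_ge0.
Qed.

Lemma psd_sum n I (r : seq I) (Q : pred I) (S : I -> 'M[R]_n) :
  (forall i, Q i -> psd (S i)) -> psd (\sum_(i <- r | Q i) S i).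
Proof. by move=> psdS; apply: big_ind => //; [exact: psd0|exact: psdD]. Qed.

Lemma psd_scalar k (a : R) : 0 <= a -> psd (a%:M : 'M[R]_k).
Proof.
move=> a0; split; first exact: tr_scalar_mx.
by move=> z; rewrite -scalemx1 bformZm mulr_ge0 // /bform mulmx1 sqnorm_ge0.
Qed.

(** A factorization through Gram matrices makes Kronecker products tractable. The
    factor is built by peeling: subtracting the rank-one matrix
    (S e)(S e)^T / (e^T S e), with e a basis vector, leaves a matrix that is
    positive semidefinite by Cauchy-Schwarz and annihilates e in addition to the
    basis vectors annihilated by S. *)
Lemma psd_factor n (S : 'M[R]_n) :
  psd S -> exists r (F : 'M[R]_(n, r)), S = F *m F^T.
Proof.
move=> Spsd.
suff peel k S' : psd S' ->
    (forall i : 'I_n, (k <= i)%N -> S' *m (delta_mx i 0 : 'cV_n) = 0) ->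
    exists r (F : 'M[R]_(n, r)), S' = F *m F^T.
  by apply: (peel n) => // i; rewrite leqNgt ltn_ord.
elim: k S' {S Spsd} => [|k IH] S Spsd Sk.
  exists 0%N, 0; rewrite mul0mx; apply/matrixP => i j.
  by have := Sk j isT; rewrite -colE => /colP /(_ i); rewrite !mxE.
have [lt_kn|le_nk] := ltnP k n; last first.
  by apply: IH => // i le_ki; have := ltn_ord i; rewrite ltnNge (leq_trans le_nk).
pose e : 'cV[R]_n := delta_mx (Ordinal lt_kn) 0.
have Ske (i : 'I_n) : (k <= i)%N -> i != Ordinal lt_kn -> S *m (delta_mx i 0 : 'cV_n) = 0.
  move=> le_ki ne; apply: Sk; rewrite ltn_neqAle le_ki andbT.
  by apply: contra ne => /eqP ki; apply/eqP/val_inj.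
(* If e^T S e = 0, then S already annihilates e. *)
have [e0|ne0] := eqVneq (bform S e e) 0.
  apply: IH => // i le_ki; have [->|] := eqVneq i (Ordinal lt_kn); last exact: Ske.
  exact: psd_ker.
have [Ssym Sge] := Spsd.
have a_gt0 : 0 < bform S e e by rewrite lt_def ne0 Sge.
pose f := Num.sqrt (bform S e e)^-1 *: (S *m e).
have ffE : f *m f^T = (bform S e e)^-1 *: (S *m e *m (S *m e)^T).
  rewrite /f linearZ /= -scalemxAl -scalemxAr scalerA -expr2 sqr_sqrtr //.
  by rewrite invr_ge0 ltW.
have ffz z w : bform (f *m f^T) z w = (bform S e e)^-1 * (bform S e z * bform S e w).
  rewrite ffE bformZm; congr (_ * _); rewrite (bformC e z) // /bform.
  have -> : z^T *m (S *m e *m (S *m e)^T) *m w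
          = (z^T *m S *m e) *m (e^T *m S *m w).
    by rewrite trmx_mul Ssym !mulmxA.
  by rewrite mxE big_ord1.
have psdSf : psd (S - f *m f^T).
  split; first by rewrite linearB /= Ssym trmx_mul trmxK.
  move=> z; rewrite bformBm ffz subr_ge0.
  by rewrite ler_pdivrMl // -expr2; exact: psd_cauchy_schwarz.
have [|r [F SE]] := IH _ psdSf.
  move=> i le_ki; rewrite mulmxBl ffE -scalemxAl.
  have -> : S *m e *m (S *m e)^T *m (delta_mx i 0 : 'cV_n)
          = S *m e *m (e^T *m (S *m (delta_mx i 0 : 'cV_n))).
    by rewrite trmx_mul Ssym !mulmxA.
  have [->|ne] := eqVneq i (Ordinal lt_kn); last first.
    by rewrite Ske // !mulmx0 scaler0 subr0.
  rewrite -/e [e^T *m _]mx11_scalar mulmxA -/(bform S e e) mul_mx_scalar scalerA.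
  by rewrite mulVf // scale1r subrr.
exists (1 + r)%N, (row_mx f F); rewrite tr_row_mx mul_row_col -SE.
by rewrite addrCA subrr addr0.
Qed.

(** (F F^T) *t (F' F'^T) = (F *t F') (F *t F')^T. *)
Lemma psd_tens n k (S : 'M[R]_n) (S' : 'M[R]_k) :
  psd S -> psd S' -> psd (S *t S').
Proof.
move=> /psd_factor [r [F ->]] /psd_factor [r' [F' ->]].
by rewrite -tensmx_mul -trmx_tens; exact: psd_gram.
Qed.

End PSD.

(** * The eigenvectors of a symmetric matrix span its range *)

Section Spectral.
Variable R : rcfType.

(** Over the complex numbers S is unitarily diagonalizable with a real diagonal,
    which is not zero because S is not. A nonzero diagonal entry is a root of the
    characteristic polynomial of S, hence an eigenvalue over the real field. *)
Lemma symmetric_eigenvector n (S : 'M[R]_n) : S^T = S -> S != 0 ->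
  exists2 a : R, a != 0 & exists2 q : 'cV[R]_n, q != 0 & S *m q = a *: q.
Proof.
move=> Ssym Sn0.
pose f := @real_complex R.
pose SC := map_mx f S.
have SCsym : SC \is hermsymmx.
  apply: realsym_hermsym.
    apply/is_hermitianmxP; rewrite expr0 scale1r map_mx_id // /SC.
    by rewrite [RHS]map_trmx Ssym.
  by apply/mxOverP => i j; rewrite mxE /f; apply/complex_realP; exists (S i j).
have /orthomx_spectralP SCE := hermitian_normalmx SCsym.
have dreal := hermitian_spectral_diag_real SCsym.
have [d0|dn0] := eqVneq (spectral_diag SC) 0.
  move: SCE; rewrite d0 raddf0 mulmx0 mul0mx => /eqP; rewrite map_mx_eq0.
  by rewrite (negPf Sn0).
have [j dj] : exists j, spectral_diag SC 0 j != 0.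
  by apply/existsP; apply: contraNT dn0 => /existsPn d0; apply/eqP/rowP => j;
     rewrite mxE; have := d0 j; rewrite negbK => /eqP.
have /complex_realP [a aE] : spectral_diag SC 0 j \is Num.real by exact: (mxOverP dreal).
have /eigenvalueP [v /eqP vS vn0] : eigenvalue S a.
  rewrite eigenvalue_root_char -(fmorph_root f) map_char_poly -eigenvalue_root_char.
  apply/eigenvalueP; exists (row j (spectralmx SC)).
    have PSC : spectralmx SC *m SC = diag_mx (spectral_diag SC) *m spectralmx SC.
      by rewrite [X in _ *m X]SCE !mulmxA mulmxV ?spectral_unit // mul1mx.
    by rewrite -row_mul PSC row_mul row_diag_mx -scalemxAl -rowE aE.
  apply: contraTneq (spectral_unit SC) => r0.
  have /row_freeP [X XE] : row_free (spectralmx SC) by rewrite row_free_unit spectral_unit.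
  have := congr1 (row j) XE; rewrite row_mul r0 mul0mx => /rowP /(_ j).
  by rewrite !mxE eqxx => /eqP; rewrite eq_sym oner_eq0.
exists a; first by apply: contraNneq dj => a0; rewrite aE a0.
exists v^T; first by rewrite -(inj_eq trmx_inj) trmxK trmx0.
by rewrite -{1}Ssym -trmx_mul (eqP vS) linearZ.
Qed.

End Spectral.

Section EigenFamily.
Variables (R : realType) (n r : nat) (P : 'M[R]_n) (e : 'I_r -> 'cV[R]_n).
Hypothesis e_eig : orthonormal_eigenvectors P e.
Let V : 'M[R]_(n, r) := mx_of_cols e.

Lemma dotv_colsE (x : 'cV[R]_n) : \col_i dotv x (e i) = V^T *m x.
Proof. by apply/colP => i; rewrite !mxE; apply: eq_bigr => k _; rewrite !mxE mulrC. Qed.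

Lemma cols_orthonormal : V^T *m V = 1%:M.
Proof.
have [eon _ _] := e_eig; apply/matrixP => i j; rewrite [RHS]mxE -eon !mxE.
by apply: eq_bigr => k _; rewrite !mxE.
Qed.

Lemma cols_lin_comb (c : 'I_r -> R) : \sum_i c i *: e i = V *m \col_i c i.
Proof.
apply/colP => k; rewrite summxE !mxE; apply: eq_bigr => i _.
by rewrite !mxE mulrC.
Qed.

Lemma cols_eigen : exists2 d : 'rV[R]_r,
  P *m V = V *m diag_mx d & forall i, d 0 i != 0.
Proof.
have [_ eP _] := e_eig.
have /choice [a aP] : forall i, exists a, a != 0 /\ P *m e i = a *: e i.
  by move=> i; have [a] := eP i; exists a.
exists (\row_i a i) => [|i]; last by rewrite mxE; case: (aP i).
apply/matrixP => k i; rewrite mul_mx_diag !mxE mulrC.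
have /colP /(_ k) := (aP i).2; rewrite !mxE => <-.
by apply: eq_bigr => l _; rewrite !mxE.
Qed.

(** P V = V D with D diagonal and invertible, so V = P (V D^-1). *)
Lemma cols_range : exists W, V = P *m W.
Proof.
have [d PV d0] := cols_eigen.
exists (V *m diag_mx (\row_i (d 0 i)^-1)).
rewrite mulmxA PV -mulmxA -[LHS]mulmx1; congr (_ *m _).
apply/matrixP => i j; rewrite mul_diag_mx !mxE.
by case: eqVneq => [->|_]; rewrite ?mulr1n ?mulr0n ?mulr0 // divff.
Qed.

(** The projector Q commutes with P, so P Q is symmetric. An eigenvector of P Q
    with a nonzero eigenvalue would be an eigenvector of P orthogonal to all the
    e i, although it lies in their span. Hence P Q = 0. *)
Lemma cols_kernel : P^T = P -> P *m (1%:M - V *m V^T) = 0.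
Proof.
move=> Psym; set Q := 1%:M - _; have [d PV _] := cols_eigen.
have Qsym : Q^T = Q by rewrite /Q linearB /= trmx1 trmx_mul trmxK.
have QV : Q *m V = 0 by rewrite /Q mulmxBl mul1mx -mulmxA cols_orthonormal mulmx1 subrr.
have QQ : Q *m Q = Q by rewrite {2}/Q mulmxBr mulmx1 mulmxA QV mul0mx subr0.
have PQ : P *m Q = Q *m P.
  have VVP : V *m V^T *m P = V *m diag_mx d *m V^T.
    apply: trmx_inj; rewrite !trmx_mul trmxK tr_diag_mx Psym mulmxA PV.
    by rewrite mulmxA.
  by rewrite /Q mulmxBr mulmxBl mulmx1 mul1mx mulmxA PV VVP.
apply/eqP/negPn/negP => /symmetric_eigenvector.
case=> [|a a0 [q q0 qE]]; first by rewrite trmx_mul Psym Qsym PQ.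
have Qq : Q *m q = q.
  apply: (scalerI a0).
  by rewrite scalemxAr -qE mulmxA PQ mulmxA QQ.
have [_ _ espan] := e_eig.
have [|c qc] := espan q a a0; first by rewrite -{1}Qq mulmxA.
by move/eqP: q0; apply; rewrite -Qq qc cols_lin_comb mulmxA QV mul0mx.
Qed.

End EigenFamily.

(** * Integrals over initial segments and Gronwall's lemma *)

Section ScalarIntegral.
Variable R : realType.
Local Notation mu := (@lebesgue_measure R).
Implicit Types (f g : R -> R) (s t T K : R).

Lemma integrable_sub D f g : measurable D ->
  mu.-integrable D (EFin \o f) -> mu.-integrable D (EFin \o g) ->
  mu.-integrable D (EFin \o (fun r => f r - g r)).
Proof.
move=> mD fint gint; apply: (eq_integrable mD) (integrableB mD fint gint).
by move=> r _ /=; rewrite EFinB.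
Qed.

Lemma integrable_scale D k f : measurable D ->
  mu.-integrable D (EFin \o f) -> mu.-integrable D (EFin \o (fun r => k * f r)).
Proof.
move=> mD fint; apply: (eq_integrable mD) (integrableZl mD k fint).
by move=> r _ /=; rewrite EFinM.
Qed.

Lemma integrable_prefix f s t : s <= t ->
  mu.-integrable `[0, t] (EFin \o f) -> mu.-integrable `[0, s] (EFin \o f).
Proof.
move=> st; apply: integrableS => //.
by apply: subset_itvl; rewrite bnd_simp.
Qed.

Lemma integrable_slice f s t : 0 <= s ->
  mu.-integrable `[0, t] (EFin \o f) -> mu.-integrable `]s, t] (EFin \o f).
Proof.
move=> s0; apply: integrableS => //.
by apply: subset_itvr; rewrite bnd_simp.
Qed.

Lemma Rintegral_slice f s t : 0 <= s <= t ->
  mu.-integrable `[0, t] (EFin \o f) ->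
  \int[mu]_(r in `[0, t]) f r - \int[mu]_(r in `[0, s]) f r =
  \int[mu]_(r in `]s, t]) f r.
Proof. by case/andP=> s0 st fint; rewrite Rintegral_itvB // bnd_simp. Qed.


Lemma integrable_cst_itv (c s t : R) (x y : bool) :
  mu.-integrable [set` Interval (BSide x s) (BSide y t)] (EFin \o fun=> c).
Proof.
apply: measurable_bounded_integrable => //; last exact: bounded_cst.
by rewrite /= lebesgue_measure_itv /=; case: ifPn => // _; rewrite -EFinB ltry.
Qed.

Lemma Rintegral_slice_cst (c s t : R) : s <= t ->
  \int[mu]_(r in `]s, t]) c = c * (t - s).
Proof.
move=> st; rewrite Rintegral_cst //= lebesgue_measure_itv /= lte_fin.
by case: ltgtP st => //= ->; rewrite subrr.
Qed.

Lemma Rintegral_slice_le f s t K : 0 <= s <= t ->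
  mu.-integrable `[0, t] (EFin \o f) ->
  (forall r, s < r <= t -> f r <= K) ->
  \int[mu]_(r in `[0, t]) f r - \int[mu]_(r in `[0, s]) f r <= K * (t - s).
Proof.
move=> /[dup] st /andP[s0 le_st] fint fK; rewrite Rintegral_slice // -Rintegral_slice_cst //.
by apply: le_Rintegral => //; [exact: integrable_slice|exact: integrable_cst_itv].
Qed.

Lemma Rintegral_prefixN f t : mu.-integrable `[0, t] (EFin \o f) ->
  \int[mu]_(r in `[0, t]) - f r = - \int[mu]_(r in `[0, t]) f r.
Proof.
move=> fint; under eq_Rintegral do rewrite -mulN1r.
by rewrite RintegralZl // mulN1r.
Qed.

Lemma Rintegral_slice_norm f s t K : 0 <= s <= t ->
  mu.-integrable `[0, t] (EFin \o f) ->
  (forall r, s < r <= t -> `|f r| <= K) ->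
  `|\int[mu]_(r in `[0, t]) f r - \int[mu]_(r in `[0, s]) f r| <= K * (t - s).
Proof.
move=> /[dup] st /andP[s0 le_st] fint fK; rewrite ler_norml lerNl opprB.
apply/andP; split; last first.
  by apply: Rintegral_slice_le => // r /fK; exact/le_trans/ler_norm.
have := @Rintegral_slice_le (fun r => - f r) s t K st.
rewrite (Rintegral_prefixN fint) (Rintegral_prefixN (integrable_prefix le_st fint)).
rewrite opprK addrC; apply; last by move=> r /fK; apply/le_trans; rewrite -normrN ler_norm.
by exact: integrableN fint.
Qed.

(** The one-step estimate of the Euler scheme. *)
(** First-order expansion of the integral of a function that is Lipschitz at s:
    the local error estimate of the explicit Euler scheme. *)
Lemma Rintegral_slice_step f s t K : 0 <= s <= t ->
  mu.-integrable `[0, t] (EFin \o f) ->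
  (forall r, s < r <= t -> `|f r - f s| <= K * (r - s)) -> 0 <= K ->
  `|\int[mu]_(r in `[0, t]) f r - \int[mu]_(r in `[0, s]) f r - (t - s) * f s|
  <= K * (t - s) ^+ 2.
Proof.
move=> /[dup] st /andP[s0 le_st] fint flip K0.
have := @Rintegral_slice_norm (fun r => f r - f s) s t (K * (t - s)) st.
have fsint : mu.-integrable `[0, t] (EFin \o (fun r => f r - f s)).
  by apply: integrable_sub => //; exact: integrable_cst_itv.
rewrite (Rintegral_slice st fsint) (Rintegral_slice st fint).
rewrite RintegralB //; last 2 first.
- exact: integrable_slice.
- exact: integrable_cst_itv.
rewrite Rintegral_slice_cst // (mulrC (f s)) expr2 mulrA; apply => //.
move=> r /andP[sr rt]; apply: le_trans (flip _ _) _; first by rewrite sr.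
by rewrite ler_wpM2l // lerB.
Qed.

(** Gronwall's lemma with zero initial value and an integrable coefficient g. Let
    I(t) be the integral of rho over [0, t]. If I(s) = 0 and g has integral at
    most 1/2 over [s, t], then I(t) <= I(t)/2, since phi <= I <= I(t) on [s, t];
    so I(t) = 0. As the integral of g is continuous, this step moves past the
    supremum of the zeros of I, unless that supremum is T. *)
Lemma gronwall_zero T (g rho phi : R -> R) : 0 <= T ->
  mu.-integrable `[0, T] (EFin \o g) -> mu.-integrable `[0, T] (EFin \o rho) ->
  (forall s, 0 <= s <= T -> 0 <= g s) ->
  (forall s, 0 <= s <= T -> 0 <= rho s <= g s * phi s) ->
  (forall t, 0 <= t <= T -> phi t <= \int[mu]_(s in `[0, t]) rho s) ->
  forall t, 0 <= t <= T -> phi t <= 0.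
Proof.
move=> T0 gint rhoint g0 rho0 phile.
pose I t := \int[mu]_(s in `[0, t]) rho s.
pose G t := \int[mu]_(s in `[0, t]) g s.
have Imono s t : 0 <= s <= t -> t <= T -> I s <= I t.
  move=> /[dup] st /andP[s0 le_st] tT; rewrite -subr_ge0 Rintegral_slice //; last first.
    exact: integrable_prefix rhoint.
  apply: Rintegral_ge0 => r /=; rewrite in_itv /= => /andP[sr rt].
  have /andP[] : 0 <= rho r <= g r * phi r.
    by rewrite rho0 // (le_trans s0 (ltW sr)) (le_trans rt).
  by [].
have Ige0 t : 0 <= t <= T -> 0 <= I t.
  move=> /andP[t0 tT]; apply: Rintegral_ge0 => r /=; rewrite in_itv /= => /andP[r0 rt].
  by have /andP[] : 0 <= rho r <= g r * phi r by rewrite rho0 // r0 (le_trans rt).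
have step s t : 0 <= s <= t -> t <= T -> I s = 0 -> G t - G s <= 2^-1 -> I t = 0.
  move=> /[dup] st /andP[s0 le_st] tT Is0 Gst.
  have t0 : 0 <= t by exact: le_trans le_st.
  suff : I t <= I t * 2^-1 by have := Ige0 t; rewrite t0 tT => /(_ isT); lra.
  apply: (@le_trans _ _ (I t * (G t - G s))); last first.
    by rewrite ler_wpM2l // Ige0 // t0.
  rewrite -[X in X <= _]subr0 -{1}Is0 /G Rintegral_slice //; last first.
    exact: integrable_prefix gint.
  rewrite Rintegral_slice //; last exact: integrable_prefix rhoint.
  rewrite -RintegralZl //; last by apply: integrable_slice => //; exact: integrable_prefix gint.
  have gsint : mu.-integrable `]s, t] (EFin \o g).
    by apply: integrable_slice => //; exact: integrable_prefix gint.
  apply: le_Rintegral => //.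
  - by apply: integrable_slice => //; exact: integrable_prefix rhoint.
  - exact: integrable_scale gsint.
  move=> r /=; rewrite in_itv /= => /andP[sr rt].
  have r0 : 0 <= r by rewrite (le_trans s0) // ltW.
  have rT : r <= T by rewrite (le_trans rt).
  have /andP[_ /le_trans] : 0 <= rho r <= g r * phi r by rewrite rho0 ?r0.
  apply; rewrite mulrC ler_wpM2r // ?g0 ?r0 //.
  by apply: le_trans (phile _ _) _; rewrite ?r0 // Imono // r0.
have IT0 : I T = 0.
  pose E := [set t | 0 <= t <= T /\ I t = 0].
  have E0 : E 0 by split; rewrite ?lexx // /I set_itv1 Rintegral_set1.
  have Esup : has_sup E by split; [exists 0|exists T => t [/andP[]]].
  pose tau := sup E.
  have tau0 : 0 <= tau by exact: (ub_le_sup Esup.2).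
  have tauT : tau <= T by apply: ge_sup; [exists 0|move=> t [/andP[]]].
  have := parameterized_integral_continuous T0 gint.
  move=> /subspace_continuousP /(_ tau).
  rewrite /= in_itv /= tau0 tauT => /(_ isT) /cvgrPdist_lt /(_ 4^-1).
  rewrite invr_gt0 ltr0n => /(_ isT); rewrite near_withinE => -[d /= d0 Gd].
  have [s [/andP[s0 sT] Is0] sd] := sup_adherent d0 Esup.
  have s_tau : s <= tau by apply: (ub_le_sup Esup.2); split; rewrite ?s0.
  pose t := Num.min T (tau + d / 2).
  have tT : t <= T by rewrite ge_min lexx.
  have tau_t : tau <= t by rewrite le_min tauT /=; lra.
  have It0 : I t = 0.
    apply: (@step s) => //; first by rewrite s0 (le_trans s_tau).
    have Gt : `|G tau - G t| < 4^-1.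
      apply: Gd; rewrite /= ?in_itv /= ?tT ?(le_trans tau0) //.
      rewrite distrC ger0_norm ?subr_ge0 //.
      have : t <= tau + d / 2 by rewrite ge_min lexx orbT.
      by lra.
    have Gs : `|G tau - G s| < 4^-1.
      apply: Gd; rewrite /= ?in_itv /= ?s0 ?sT //.
      by rewrite ger0_norm ?subr_ge0 // ltrBlDl -ltrBlDr.
    move: Gt Gs; rewrite !ltr_norml => /andP[? ?] /andP[? ?]; lra.
  have : t <= tau by apply: (ub_le_sup Esup.2); split; rewrite ?(le_trans tau0).
  rewrite ge_min => /orP[Ttau|]; last by lra.
  by have -> : T = t by apply: le_anti; rewrite tT (le_trans Ttau).
move=> t /[dup] tT /andP[t0 le_tT].
by apply: le_trans (phile t tT) _; rewrite -[leRHS]IT0; apply: Imono => //; rewrite t0.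
Qed.

(** Concludes the arguments by first-order expansion: the bound K h on a comes from
    dividing an error of order h^2 by the step h. *)
Lemma small_multiple_le0 (a K d : R) : 0 < d -> 0 <= K ->
  (forall h, 0 < h < d -> a <= K * h) -> a <= 0.
Proof.
move=> d0 K0 aK; rewrite leNgt; apply/negP => a0.
have K1 : 0 < K + 1 by rewrite ltr_wpDl.
pose h := Num.min (d / 2) (a / (2 * (K + 1))).
have h0 : 0 < h by rewrite lt_min !divr_gt0 ?mulr_gt0.
have hd : h < d by rewrite (@le_lt_trans _ _ (d / 2)) ?ge_min ?lexx //; lra.
have := aK h; rewrite h0 hd => /(_ isT); apply/negP; rewrite -ltNge.
apply: (@le_lt_trans _ _ ((K + 1) * (a / (2 * (K + 1))))).
  by apply: ler_pM => //; [exact: ltW|rewrite lerDl|rewrite ge_min lexx orbT].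
have -> : (K + 1) * (a / (2 * (K + 1))) = a / 2 by field; rewrite lt0r_neq0.
by lra.
Qed.

Definition lipschitz_upto T f := exists2 K, 0 <= K &
  forall s t, 0 <= s <= t -> t <= T -> `|f t - f s| <= K * (t - s).

Lemma lipschitz_upto_integrable T f : lipschitz_upto T f ->
  mu.-integrable `[0, T] (EFin \o f).
Proof.
move=> [K K0 lip]; apply: continuous_compact_integrable; first exact: segment_compact.
apply/subspace_continuousP => x; rewrite /= in_itv /= => /andP[x0 xT].
apply/cvgrPdist_lt => e e0; rewrite near_withinE.
exists (e / (K + 1)) => /=; first by rewrite divr_gt0 // ltr_wpDl.
move=> y /= xy; rewrite in_itv /= => /andP[y0 yT].
have K1 : 0 < K + 1 by rewrite ltr_wpDl.
have bound : `|f x - f y| <= K * `|x - y|.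
  have [le_xy|lt_yx] := leP (x : R) y.
    by rewrite distrC [X in K * X]distrC [X in K * X]ger0_norm ?subr_ge0 // lip ?x0.
  rewrite [X in K * X]ger0_norm; last by rewrite subr_ge0 ltW.
  by apply: lip xT; rewrite y0 ltW.
apply: le_lt_trans bound _; move: xy; rewrite ltr_pdivlMr // => xy.
apply: le_lt_trans xy; rewrite mulrC ler_wpM2l //.
by rewrite lerDl.
Qed.

(** The mean of a nonnegative Lipschitz function over a shrinking right
    neighbourhood tends to its value. *)
(** All integrals over subintervals of [0, T[ vanish, so the first-order expansion
    at s leaves h f(s) = O(h^2). The right end point is excluded because f is
    expanded to the right of s. *)
Lemma lipschitz_upto_integral_eq0 T f : lipschitz_upto T f ->
  (forall s, 0 <= s < T -> 0 <= f s) -> \int[mu]_(r in `[0, T]) f r <= 0 ->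
  forall s, 0 <= s < T -> f s = 0.
Proof.
move=> /[dup] lipf [K K0 lip] f0 If0 s /andP[s0 sT].
have fint := lipschitz_upto_integrable lipf.
have pos a b : 0 <= a <= b -> b < T ->
    0 <= \int[mu]_(r in `[0, b]) f r - \int[mu]_(r in `[0, a]) f r.
  move=> /[dup] ab /andP[a0 _] bT; rewrite Rintegral_slice //; last first.
    exact: integrable_prefix (ltW bT) fint.
  apply: Rintegral_ge0 => r; rewrite /= in_itv /= => /andP[ar rb].
  by rewrite f0 // (le_trans a0) ?ltW //= (le_lt_trans rb).
have I0 : \int[mu]_(r in `[0, 0]) f r = 0 by rewrite set_itv1 Rintegral_set1.
have Ile t : 0 <= t < T -> \int[mu]_(r in `[0, t]) f r <= 0.
  move=> /andP[t0 tT]; apply: le_trans If0; rewrite -subr_ge0.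
  have le_tT := ltW tT; rewrite Rintegral_slice ?t0 //.
  rewrite -Rintegral_itv_bndo_bndc //; last first.
    apply: integrableS fint => //.
    by apply: subset_itv; rewrite bnd_simp.
  apply: Rintegral_ge0 => r; rewrite /= in_itv /= => /andP[tr rT].
  by rewrite f0 // rT (le_trans t0) ?ltW.
have IE t : 0 <= t < T -> \int[mu]_(r in `[0, t]) f r = 0.
  move=> /[dup] t0T /andP[t0 tT]; apply: le_anti; rewrite Ile //=.
  by have := @pos 0 t; rewrite I0 subr0; apply; rewrite ?lexx.
have small t : s < t < T -> f s <= K * (t - s).
  move=> /andP[st tT]; have t0 : 0 <= t by rewrite (le_trans s0) ?ltW.
  have := @Rintegral_slice_step f s t K; rewrite !IE ?s0 ?t0 ?(ltW st) //.
  rewrite subrr sub0r normrN normrM => step.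
  have ts : 0 < t - s by rewrite subr_gt0.
  have {step} : `|t - s| * `|f s| <= K * (t - s) ^+ 2.
    apply: step => //; first exact: integrable_prefix (ltW tT) fint.
    move=> r /andP[sr rt]; apply: lip; first by rewrite s0 ltW.
    by rewrite (le_trans rt) // ltW.
  rewrite (gtr0_norm ts) expr2 mulrCA ler_pM2l // => /(le_trans _); apply.
  exact: ler_norm.
apply: le_anti; rewrite f0 ?s0 // andbT.
apply: (@small_multiple_le0 _ K (T - s)); rewrite ?subr_gt0 // => h /andP[h0 hT].
have := small (s + h); rewrite ltrDl h0 -ltrBrDl hT => /(_ isT).
by rewrite addrAC subrr add0r.
Qed.

End ScalarIntegral.

(** * Entrywise norm and integrals of matrix functions *)

Section L1Norm.
Variable R : realType.

(** Unlike the maximum norm, the entrywise 1-norm is submultiplicative for matrix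
    products; it is also multiplicative for Kronecker products. *)
Definition l1 a b (X : 'M[R]_(a, b)) : R := \sum_i \sum_j `|X i j|.

Lemma l1_ge0 a b (X : 'M[R]_(a, b)) : 0 <= l1 X.
Proof. by do 2!apply: sumr_ge0 => ? _. Qed.

Lemma le_l1 a b (X : 'M[R]_(a, b)) i j : `|X i j| <= l1 X.
Proof.
rewrite /l1 (bigD1 i) //= (bigD1 j) //= -addrA lerDl addr_ge0 //.
  exact: sumr_ge0.
by do 2!apply: sumr_ge0 => ? _.
Qed.

Lemma l1_eq0 a b (X : 'M[R]_(a, b)) : l1 X <= 0 -> X = 0.
Proof.
move=> X0; apply/matrixP => i j; rewrite mxE; apply/eqP.
by rewrite -normr_le0 (le_trans (le_l1 X i j)).
Qed.

Lemma ler_l1D a b (X Y : 'M[R]_(a, b)) : l1 (X + Y) <= l1 X + l1 Y.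
Proof.
rewrite /l1 -big_split; apply: ler_sum => i _; rewrite -big_split.
by apply: ler_sum => j _; rewrite mxE ler_normD.
Qed.

Lemma l1Z a b (X : 'M[R]_(a, b)) c : l1 (c *: X) = `|c| * l1 X.
Proof.
rewrite /l1 mulr_sumr; apply: eq_bigr => i _; rewrite mulr_sumr.
by apply: eq_bigr => j _; rewrite mxE normrM.
Qed.

Lemma ler_l1_sum a b I (r : seq I) (F : I -> 'M[R]_(a, b)) :
  l1 (\sum_(i <- r) F i) <= \sum_(i <- r) l1 (F i).
Proof.
elim: r => [|i r IH]; last by rewrite !big_cons (le_trans (ler_l1D _ _)) // lerD2l.
rewrite !big_nil /l1 big1 // => i _; rewrite big1 // => j _.
by rewrite mxE normr0.
Qed.

Lemma l1_mul a b c (X : 'M[R]_(a, b)) (Y : 'M[R]_(b, c)) :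
  l1 (X *m Y) <= l1 X * l1 Y.
Proof.
rewrite /l1 mulr_suml; apply: ler_sum => i _.
rewrite mulr_suml; under [leRHS]eq_bigr do rewrite mulr_sumr.
have -> : \sum_(j < b) \sum_(k < b) `|X i j| * (\sum_(l < c) `|Y k l|) =
  \sum_(j < b) `|X i j| * l1 Y by apply: eq_bigr => j _; rewrite -mulr_sumr.
apply: (@le_trans _ _ (\sum_(l < c) \sum_(j < b) `|X i j| * `|Y j l|)).
  apply: ler_sum => l _; rewrite mxE (le_trans (ler_norm_sum _ _ _)) //.
  by apply: ler_sum => j _; rewrite normrM.
rewrite exchange_big /=; apply: ler_sum => j _; rewrite -mulr_sumr.
by rewrite ler_wpM2l // /l1 [leRHS](bigD1 j) //= lerDl; do 2!apply: sumr_ge0 => ? _.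
Qed.

Lemma l1_tens a b c d (X : 'M[R]_(a, b)) (Y : 'M[R]_(c, d)) :
  l1 (X *t Y) = l1 X * l1 Y.
Proof.
rewrite /l1 mulr_sum; apply: eq_bigr => i _; rewrite mulr_sum.
by apply: eq_bigr => j _; rewrite mxE normrM.
Qed.

End L1Norm.

Section LinearMaps.
Variables (R : realType) (a b c d : nat) (L : {linear 'M[R]_(a, b) -> 'M[R]_(c, d)}).

Lemma linear_coordE X i j :
  L X i j = \sum_k \sum_l (L (delta_mx k l) i j * X k l).
Proof.
rewrite {1}[X]matrix_sum_delta linear_sum summxE; apply: eq_bigr => k _.
rewrite linear_sum summxE; apply: eq_bigr => l _.
by rewrite linearZ mxE mulrC.
Qed.

Lemma linear_l1_bound : exists2 C, 0 <= C & forall X, l1 (L X) <= C * l1 X.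
Proof.
exists (\sum_k \sum_l l1 (L (delta_mx k l))) => [|X].
  by do 2!apply: sumr_ge0 => ? _; exact: l1_ge0.
rewrite {1}[X]matrix_sum_delta linear_sum mulr_suml (le_trans (ler_l1_sum _ _)) //.
apply: ler_sum => k _; rewrite linear_sum mulr_suml (le_trans (ler_l1_sum _ _)) //.
apply: ler_sum => l _; rewrite linearZ l1Z mulrC.
by rewrite ler_wpM2l ?l1_ge0 // le_l1.
Qed.

End LinearMaps.

Section MatrixIntegralTheory.
Variable R : realType.
Local Notation mu := (@lebesgue_measure R).

Lemma integrable_real_sum (D : set (measurableTypeR R)) I (r : seq I) (f : I -> R -> R) :
  measurable D -> (forall i, mu.-integrable D (EFin \o f i)) ->
  mu.-integrable D (EFin \o (fun s => \sum_(i <- r) f i s)) /\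
  \int[mu]_(s in D) (\sum_(i <- r) f i s) = \sum_(i <- r) \int[mu]_(s in D) f i s.
Proof.
move=> mD fint; elim: r => [|i r [IHint IH]].
  split.
    have -> : EFin \o (fun s => \sum_(i <- [::]) f i s) = cst 0%E.
      by apply/funext => s /=; rewrite big_nil.
    exact: integrable0.
  by under eq_Rintegral do rewrite big_nil; rewrite big_nil Rintegral_cst // mul0r.
split.
  apply: (eq_integrable mD) (integrableD mD (fint i) IHint).
  by move=> s _ /=; rewrite big_cons EFinD.
under eq_Rintegral do rewrite big_cons.
by rewrite RintegralD // IH big_cons.
Qed.

Lemma mx_integral_linear a b c d (L : {linear 'M[R]_(a, b) -> 'M[R]_(c, d)})
    (D : set R) (F : R -> 'M[R]_(a, b)) :
  measurable D -> mx_integrable D F ->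
  mx_integrable D (fun s => L (F s)) /\
  L (mx_integral D F) = mx_integral D (fun s => L (F s)).
Proof.
move=> mD Fint.
have term i j k l : mu.-integrable D (EFin \o (fun s => L (delta_mx k l) i j * F s k l)).
  by apply: integrable_scale => //; exact: Fint.
have row i j k := integrable_real_sum (index_enum _) mD (term i j k).
have all i j := integrable_real_sum (index_enum _) mD (fun k => (row i j k).1).
have LE i j : (fun s => L (F s) i j) =
    (fun s => \sum_k \sum_l (L (delta_mx k l) i j * F s k l)).
  by apply/funext => s; rewrite linear_coordE.
split=> [i j|].
  have := (all i j).1; rewrite -LE; apply.
apply/matrixP => i j; rewrite linear_coordE [RHS]mxE LE (all i j).2.
apply: eq_bigr => k _; rewrite (row i j k).2; apply: eq_bigr => l _.
by rewrite mxE RintegralZl //; exact: Fint.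
Qed.

Lemma l1_integral_le a b t (F : R -> 'M[R]_(a, b)) : mx_integrable `[0, t] F ->
  mu.-integrable `[0, t] (EFin \o (fun s => l1 (F s))) /\
  l1 (mx_integral `[0, t] F) <= \int[mu]_(s in `[0, t]) l1 (F s).
Proof.
move=> Fint; have mD : measurable `[0, t] by exact: measurable_itv.
have term i j : mu.-integrable `[0, t] (EFin \o (fun s => `|F s i j|)).
  have := @integrable_norm _ _ _ mu `[0, t] (fun s => F s i j); apply; exact: Fint.
have row i := integrable_real_sum (index_enum _) mD (term i).
have all := integrable_real_sum (index_enum _) mD (fun i => (row i).1).
split; first exact: all.1.
rewrite /l1 all.2; apply: ler_sum => i _; rewrite (row i).2.
apply: ler_sum => j _; rewrite mxE.
by apply: le_normr_Rintegral => //; exact: Fint.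
Qed.

End MatrixIntegralTheory.

(** * Linear matrix differential equations *)

Section Gronwall.
Variable R : realType.
Local Notation mu := (@lebesgue_measure R).

(** The form of Gronwall's lemma used for differential equations in integrated
    form: rho is the norm of the right-hand side. *)
Lemma gronwall_mx_zero a b T (g : R -> R) (F x : R -> 'M[R]_(a, b)) : 0 <= T ->
  mu.-integrable `[0, T] (EFin \o g) -> mx_integrable `[0, T] F ->
  (forall s, 0 <= s <= T -> 0 <= g s) ->
  (forall s, 0 <= s <= T -> l1 (F s) <= g s * l1 (x s)) ->
  (forall t, 0 <= t <= T -> x t = mx_integral `[0, t] F) ->
  forall t, 0 <= t <= T -> x t = 0.
Proof.
move=> T0 gint Fint g0 Fle xE t tT; apply: l1_eq0.
apply: (@gronwall_zero R T g (fun s => l1 (F s)) (fun s => l1 (x s))) tT => //.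
- exact: (l1_integral_le Fint).1.
- by move=> s sT; rewrite l1_ge0 Fle.
- move=> s /[dup] sT /andP[_ le_sT]; rewrite xE //.
  have Fints : mx_integrable `[0, s] F.
    by move=> i j; exact: (integrable_prefix le_sT (Fint i j)).
  exact: (l1_integral_le Fints).2.
Qed.

End Gronwall.

Section LinearODE.
Variables (R : realType) (a b : nat) (L : {linear 'M[R]_(a, b) -> 'M[R]_(a, b)}).
Local Notation mu := (@lebesgue_measure R).

Lemma linear_ode_zero (Z : R -> 'M[R]_(a, b)) :
  solves_on `[0, +oo[ (fun=> L) 0 Z -> forall t, 0 <= t -> Z t = 0.
Proof.
move=> sol T T0; have [C C0 LC] := linear_l1_bound L.
have in0 (t : R) : 0 <= t -> [set` `[0, +oo[] t by move=> t0; rewrite /= in_itv /= t0.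
apply: (@gronwall_mx_zero R a b T (fun=> C) (fun s => L (Z s))) => //.
- exact: integrable_cst_itv.
- exact: (sol T (in0 T T0)).1.
- by move=> t /andP[t0 _]; rewrite (sol t (in0 t t0)).2 add0r.
- by rewrite T0 lexx.
Qed.

Variables (Z0 : 'M[R]_(a, b)) (Z : R -> 'M[R]_(a, b)).
Hypothesis sol : solves_on `[0, +oo[ (fun=> L) Z0 Z.

Lemma linear_ode_integrable t : 0 <= t -> mx_integrable `[0, t] (fun s => L (Z s)).
Proof. by move=> t0; apply: (sol _).1; rewrite /= in_itv /= t0. Qed.

Lemma linear_ode_eq t : 0 <= t ->
  Z t = Z0 + mx_integral `[0, t] (fun s => L (Z s)).
Proof. by move=> t0; apply: (sol _).2; rewrite /= in_itv /= t0. Qed.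

Lemma linear_ode_init : Z 0 = Z0.
Proof.
rewrite linear_ode_eq //.
apply/matrixP => i j; rewrite !mxE set_itv1 Rintegral_set1 addr0 //.
Qed.

Lemma linear_ode_incr s t i j : 0 <= s <= t ->
  Z t i j - Z s i j = \int[mu]_(r in `[0, t]) (L (Z r)) i j
                    - \int[mu]_(r in `[0, s]) (L (Z r)) i j.
Proof.
case/andP=> s0 st.
rewrite (linear_ode_eq (le_trans s0 st)) (linear_ode_eq s0).
by rewrite !mxE; ring.
Qed.

Lemma linear_ode_bounded T : 0 <= T ->
  exists2 M, 0 <= M & forall t, 0 <= t <= T -> l1 (Z t) <= M.
Proof.
move=> T0; have LZint := linear_ode_integrable T0.
have [LZ1int _] := l1_integral_le LZint.
exists (l1 Z0 + \int[mu]_(s in `[0, T]) l1 (L (Z s))) => [|t /andP[t0 tT]].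
  by rewrite addr_ge0 ?l1_ge0 // Rintegral_ge0 // => s _; exact: l1_ge0.
rewrite linear_ode_eq //.
rewrite (le_trans (ler_l1D _ _)) // lerD2l.
rewrite (le_trans (l1_integral_le (linear_ode_integrable t0)).2) //.
rewrite -subr_ge0 Rintegral_slice ?t0 //.
by apply: Rintegral_ge0 => s _; exact: l1_ge0.
Qed.

Lemma linear_ode_lipschitz T : 0 <= T ->
  exists2 K, 0 <= K & forall s t, 0 <= s <= t -> t <= T ->
    l1 (Z t - Z s) <= K * (t - s).
Proof.
move=> T0; have [C C0 LC] := linear_l1_bound L.
have [M M0 ZM] := linear_ode_bounded T0.
exists (a%:R * (b%:R * (C * M))); first by rewrite !mulr_ge0.
move=> s t /[dup] st /andP[s0 le_st] tT.
rewrite /l1 (@le_trans _ _ (\sum_(k < a) \sum_(l < b) C * M * (t - s))) //.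
  apply: ler_sum => i _; apply: ler_sum => j _; rewrite !mxE linear_ode_incr //.
  apply: Rintegral_slice_norm => //.
    exact: (linear_ode_integrable (le_trans s0 le_st)).
  move=> q /andP[sq qt]; apply: le_trans (le_l1 _ _ _) _.
  apply: le_trans (LC _) _; rewrite ler_wpM2l // ZM //.
  by rewrite (le_trans s0 (ltW sq)) (le_trans qt).
rewrite !sumr_const !card_ord -[_ *+ b]mulr_natl -[_ *+ a]mulr_natl.
by rewrite !mulrA.
Qed.

(** The local error of one Euler step is quadratic, uniformly on [0, T], because Z
    and hence L(Z) are Lipschitz there. *)
Lemma linear_ode_step T : 0 <= T ->
  exists2 K, 0 <= K & forall s t i j, 0 <= s <= t -> t <= T ->
    `|Z t i j - Z s i j - (t - s) * L (Z s) i j| <= K * (t - s) ^+ 2.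
Proof.
move=> T0; have [C C0 LC] := linear_l1_bound L.
have [K K0 lip] := linear_ode_lipschitz T0.
exists (C * K); first by rewrite mulr_ge0.
move=> s t i j /[dup] st /andP[s0 le_st] tT.
rewrite linear_ode_incr //; apply: (Rintegral_slice_step st) => //.
- exact: (linear_ode_integrable (le_trans s0 le_st)).
- move=> r /andP[sr rt].
  have -> : L (Z r) i j - L (Z s) i j = L (Z r - Z s) i j by rewrite linearB /= !mxE.
  apply: le_trans (le_l1 _ _ _) _; apply: le_trans (LC _) _.
  by rewrite -mulrA ler_wpM2l // lip ?(le_trans rt) // s0 ltW.
- by rewrite mulr_ge0.
Qed.

End LinearODE.

(** * Positivity of the Lyapunov flow *)

Section TensorLinear.
Variable (R : comPzRingType) (m n p q : nat).

Definition tensl (X : 'M[R]_(m, n)) (Y : 'M[R]_(p, q)) := X *t Y.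

Lemma tensl_is_linear X : linear (tensl X).
Proof. by move=> a Y Y'; apply/matrixP => i j; rewrite !mxE mulrDr mulrCA. Qed.

HB.instance Definition _ X := GRing.isLinear.Build R 'M[R]_(p, q)
  'M[R]_(m * p, n * q) _ (tensl X) (tensl_is_linear X).

Definition tensr (Y : 'M[R]_(p, q)) (X : 'M[R]_(m, n)) := X *t Y.

Lemma tensr_is_linear Y : linear (tensr Y).
Proof. by move=> a X X'; apply/matrixP => i j; rewrite !mxE mulrDl mulrA. Qed.

HB.instance Definition _ Y := GRing.isLinear.Build R 'M[R]_(m, n)
  'M[R]_(m * p, n * q) _ (tensr Y) (tensr_is_linear Y).

End TensorLinear.

Section Lyapunov.
Variables (R : realType) (n m : nat) (A : 'M[R]_n) (N : 'M[R]_(n, m * n)).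

Lemma lyap_is_linear : linear (lyap A N).
Proof.
move=> a X Y; rewrite /lyap.
have -> : (1%:M : 'M[R]_m) *t (a *: X + Y) = a *: (1%:M *t X) + 1%:M *t Y.
  exact: tensl_is_linear.
rewrite !mulmxDr !mulmxDl.
rewrite -!scalemxAr -!scalemxAl !scalerDr -!addrA; congr (_ + _).
by rewrite addrCA; congr (_ + _); rewrite !addrA -!(addrC (_ *: (N *m _ *m _))) !addrA;
  congr (_ + _); rewrite -!addrA; congr (_ + _).
Qed.

HB.instance Definition _ :=
  GRing.isLinear.Build R 'M[R]_n 'M[R]_n _ (lyap A N) lyap_is_linear.

Lemma lyap_trmx X : lyap A N X^T = (lyap A N X)^T.
Proof.
rewrite /lyap !linearD /= !trmx_mul !trmxK trmx_tens trmx1 mulmxA.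
by rewrite [A *m X^T + _]addrC.
Qed.

Definition skew_part (X : 'M[R]_n) : 'M[R]_n := X - X^T.

Lemma skew_part_is_linear : linear skew_part.
Proof.
move=> a X Y; rewrite /skew_part linearD /= linearZ /= scalerBr.
by rewrite opprD addrACA.
Qed.

HB.instance Definition _ :=
  GRing.isLinear.Build R 'M[R]_n 'M[R]_n _ skew_part skew_part_is_linear.

(** The operator commutes with transposition, so the antisymmetric part of Z solves
    the same equation with initial value 0. *)
Lemma lyap_solution_sym (Z0 : 'M[R]_n) Z : Z0^T = Z0 ->
  solves_on `[0, +oo[ (fun=> lyap A N) Z0 Z -> forall t, 0 <= t -> (Z t)^T = Z t.
Proof.
move=> Z0sym sol t t0; apply/esym/eqP; rewrite -subr_eq0; apply/eqP.
apply: (@linear_ode_zero R n n (lyap A N) (fun s => skew_part (Z s))) t0 => s s0.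
have [intg ->] := sol s s0.
have [intg' lin] := mx_integral_linear skew_part (measurable_itv _) intg.
have lyapS r : lyap A N (skew_part (Z r)) = skew_part (lyap A N (Z r)).
  by rewrite /skew_part -lyap_trmx linearB.
split.
  by move=> i j; apply: eq_integrable (intg' i j) => // r _ /=; rewrite lyapS.
rewrite linearD /= lin {1}/skew_part Z0sym subrr; congr (_ + _).
by apply/matrixP => i j; rewrite !mxE; apply: eq_Rintegral => r _; rewrite lyapS.
Qed.

(** From |z_i z_j| <= (z_i^2 + z_j^2)/2 <= |z|^2; here bform 1%:M z z is |z|^2. *)
Lemma ler_bform_l1 (X : 'M[R]_n) z : `|bform X z z| <= l1 X * bform 1%:M z z.
Proof.
have qE : bform 1%:M z z = \sum_k z k 0 ^+ 2.
  by rewrite /bform mulmx1 mxE; apply: eq_bigr => k _; rewrite mxE expr2.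
have q_ge i : z i 0 ^+ 2 <= bform 1%:M z z.
  by rewrite qE (bigD1 i) //= lerDl sumr_ge0 // => k _; exact: sqr_ge0.
have -> : bform X z z = \sum_i \sum_j z i 0 * X i j * z j 0.
  rewrite /bform mxE exchange_big /=; apply: eq_bigr => j _.
  by rewrite mxE mulr_suml; apply: eq_bigr => i _; rewrite mxE.
rewrite (le_trans (ler_norm_sum _ _ _)) // /l1 mulr_suml; apply: ler_sum => i _.
rewrite (le_trans (ler_norm_sum _ _ _)) // mulr_suml; apply: ler_sum => j _.
rewrite !normrM mulrAC mulrC ler_wpM2l //.
have := q_ge i; have := q_ge j.
rewrite -(real_normK (num_real (z i 0))) -(real_normK (num_real (z j 0))).
have := sqr_ge0 (`|z i 0| - `|z j 0|).
set x := `|z i 0|; set y := `|z j 0|; set w := bform _ _ _.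
by rewrite sqrrB !expr2 -mulr_natl; lra.
Qed.

(** An explicit Euler step X + h L(X) for the Lyapunov operator L does not preserve
    positivity, but it does after adding the second-order term h^2 A X A^T, which
    completes the square in A. *)
Definition euler_step (h : R) (X : 'M[R]_n) : 'M[R]_n :=
  (1%:M + h *: A) *m X *m (1%:M + h *: A)^T + h *: (N *m (1%:M *t X) *m N^T).

Lemma euler_stepE h X :
  euler_step h X = X + h *: lyap A N X + h ^+ 2 *: (A *m X *m A^T).
Proof.
rewrite /euler_step /lyap linearD /= trmx1 linearZ /= !mulmxDl !mulmxDr.
rewrite !mul1mx !mulmx1 -!scalemxAl -!scalemxAr.
set AX := A *m X; set XA := X *m A^T; set AXA := AX *m A^T; set Y := N *m _ *m _.
by clearbody AXA Y; apply/matrixP => i j; rewrite !mxE; ring.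
Qed.

Lemma euler_step_psd h X : 0 <= h -> psd X -> psd (euler_step h X).
Proof.
move=> h0 psdX; apply: psdD; first exact: psd_congr.
have [Ysym Yge] := psd_congr N (psd_tens (psd_scalar m ler01) psdX).
split; first by rewrite linearZ /= Ysym.
by move=> z; rewrite bformZm mulr_ge0.
Qed.

(** Propagation of an approximate positivity S >= - lam over one step of the exact
    flow, from S to S'. The factor 1 + c h comes from applying euler_step to the
    shift lam%:M; the term k h^2 collects the local error of the flow and the
    second-order term of euler_step. *)
Lemma euler_step_shift (T M K : R) : 0 <= T -> 0 <= M -> 0 <= K ->
  exists c k : R, [/\ 0 <= c, 0 <= k & forall h lam (S S' : 'M[R]_n),
    0 <= h <= T -> 0 <= lam -> l1 S <= M -> S'^T = S' ->
    (forall i j, `|S' i j - S i j - h * lyap A N S i j| <= K * h ^+ 2) ->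
    psd (S + lam%:M) -> psd (S' + (lam * (1 + c * h) + k * h ^+ 2)%:M)].
Proof.
move=> T0 M0 K0.
pose c := l1 (lyap A N 1%:M) + T * l1 (A *m 1%:M *m A^T).
pose k := n%:R * (n%:R * K) + l1 A * M * l1 A^T.
have c0 : 0 <= c by rewrite addr_ge0 ?mulr_ge0 ?l1_ge0.
have k0 : 0 <= k by rewrite addr_ge0 ?mulr_ge0 ?l1_ge0.
exists c, k; split => // h lam S S' /andP[h0 hT] lam0 SM S'sym err psdS.
split; first by rewrite linearD /= S'sym tr_scalar_mx.
move=> z; rewrite bformDm -[X in _ + bform X _ _]scalemx1 bformZm.
set q := bform 1%:M z z.
have q0 : 0 <= q by rewrite /q /bform mulmx1 sqnorm_ge0.
pose E := S' - S - h *: lyap A N S.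
have Ele : l1 E <= n%:R * (n%:R * K) * h ^+ 2.
  apply: (@le_trans _ _ (\sum_(i < n) \sum_(j < n) K * h ^+ 2)).
    apply: ler_sum => i _; apply: ler_sum => j _; move: (err i j); rewrite /E.
    by move: (lyap A N S) => Y; rewrite !mxE.
  by rewrite !sumr_const !card_ord -[_ *+ n *+ n]mulr_natl -[K * _ *+ n]mulr_natl !mulrA.
have AE : l1 (A *m S *m A^T) <= l1 A * M * l1 A^T.
  rewrite (le_trans (l1_mul _ _)) // ler_wpM2r ?l1_ge0 //.
  by rewrite (le_trans (l1_mul _ _)) // ler_wpM2l ?l1_ge0.
(* E is the local error; the rest is the positive part minus its correction. *)
have S'E : S' = E + (euler_step h S - h ^+ 2 *: (A *m S *m A^T)).
  by rewrite euler_stepE addrK /E [S + _]addrC addrA subrK subrK.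
have eulD : euler_step h (S + lam%:M) = euler_step h S + lam *: euler_step h 1%:M.
  have lyapD : lyap A N (S + lam *: 1%:M) = lyap A N S + lam *: lyap A N 1%:M.
    by rewrite linearD linearZ.
  rewrite -[lam%:M]scalemx1 !euler_stepE lyapD mulmxDr mulmxDl -scalemxAr -scalemxAl.
  move: (lyap A N S) (lyap A N 1%:M) (A *m S *m A^T) (A *m 1%:M *m A^T) => Y1 Y2 Y3 Y4.
  by apply/matrixP => i j; rewrite !mxE; ring.
have := (euler_step_psd h0 psdS).2 z; rewrite eulD bformDm bformZm => eul_ge.
have eul1 : bform (euler_step h 1%:M) z z <= q * (1 + c * h).
  rewrite euler_stepE !bformDm !bformZm -/q.
  have := ler_bform_l1 (lyap A N 1%:M) z; have := ler_bform_l1 (A *m 1%:M *m A^T) z.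
  rewrite -/q !ler_norml => /andP[_ b1] /andP[_ b2].
  have {}b2 := ler_wpM2l h0 b2.
  have hh : 0 <= h ^+ 2 by rewrite sqr_ge0.
  have {}b1 := ler_wpM2l hh b1.
  have b3 : h ^+ 2 * (l1 (A *m 1%:M *m A^T) * q) <= h * T * (l1 (A *m 1%:M *m A^T) * q).
    by rewrite ler_wpM2r ?mulr_ge0 ?l1_ge0 // expr2 ler_wpM2l.
  by rewrite /c; lra.
have := ler_bform_l1 E z; have := ler_bform_l1 (A *m S *m A^T) z.
rewrite -/q !ler_norml => /andP[_ b1] /andP[b2 _].
have -> : bform S' z z = bform E z z + bform (euler_step h S) z z
                         - h ^+ 2 * bform (A *m S *m A^T) z z.
  rewrite {1}S'E (bformDm E) (bformBm (euler_step h S)) bformZm. by rewrite addrA.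
have {}b2 : - (n%:R * (n%:R * K) * h ^+ 2 * q) <= bform E z z.
  by apply: le_trans b2; rewrite lerN2 ler_wpM2r.
have {}b1 : h ^+ 2 * bform (A *m S *m A^T) z z <= h ^+ 2 * (l1 A * M * l1 A^T * q).
  by rewrite ler_wpM2l ?sqr_ge0 // (le_trans b1) // ler_wpM2r.
have := ler_wpM2l lam0 eul1.
by rewrite /k; lra.
Qed.

End Lyapunov.

Section LyapunovPositivity.
Variables (R : realType) (n m : nat) (A : 'M[R]_n) (N : 'M[R]_(n, m * n)).

Lemma psd_shift_le (S : 'M[R]_n) (a b : R) : a <= b ->
  psd (S + a%:M) -> psd (S + b%:M).
Proof.
move=> ab psdS; have -> : S + b%:M = S + a%:M + (b - a)%:M.
  by rewrite raddfB /= addrA addrAC addrK.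
by apply: psdD => //; apply: psd_scalar; rewrite subr_ge0.
Qed.

(** With p + 1 steps of length h = T / (p + 1), the negative part of Z(T) is at most
    (p + 1) k h^2 (1 + c h)^(p + 1) <= k T^2 e^(c T) / (p + 1), which tends to 0. *)
Lemma lyap_solution_psd (Z0 : 'M[R]_n) Z : psd Z0 ->
  solves_on `[0, +oo[ (fun=> lyap A N) Z0 Z -> forall t, 0 <= t -> psd (Z t).
Proof.
move=> psdZ0 sol T T0.
have Zsym := lyap_solution_sym psdZ0.1 sol.
split=> [|z]; first exact: Zsym.
have [M M0 ZM] := linear_ode_bounded (L := lyap A N) sol T0.
have [K K0 step] := linear_ode_step (L := lyap A N) sol T0.
have [c [k [c0 k0 shift]]] := euler_step_shift A N T0 M0 K0.
have euler p j : (j <= p.+1)%N -> let h := T / p.+1%:R in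
    psd (Z (j%:R * h) + (j%:R * (k * h ^+ 2) * (1 + c * h) ^+ j)%:M).
  move=> jp h; have h0 : 0 <= h by rewrite divr_ge0.
  have hT : h <= T by rewrite ler_pdivrMr // ler_peMr // ler1n.
  have ch0 : 0 <= c * h by rewrite mulr_ge0.
  have kh0 : 0 <= k * h ^+ 2 by rewrite mulr_ge0 ?sqr_ge0.
  have jhT i : (i <= p.+1)%N -> i%:R * h <= T.
    move=> ip; rewrite /h mulrA ler_pdivrMr ?ltr0n // mulrC ler_wpM2l // ler_nat //.
  elim: j jp => [|j IH] jp.
    rewrite !mul0r raddf0 addr0 (linear_ode_init (L := lyap A N) sol) //.
  pose lam := j%:R * (k * h ^+ 2) * (1 + c * h) ^+ j.
  have lam0 : 0 <= lam by rewrite /lam !mulr_ge0 ?exprn_ge0 ?addr_ge0.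
  have h_eq : j.+1%:R * h - j%:R * h = h by rewrite -mulrBl -natrB // subSnn mul1r.
  apply: psd_shift_le (shift h lam (Z (j%:R * h)) _ _ lam0 _ _ _ _).
  - have p1 : 1 <= (1 + c * h) ^+ j.+1 by rewrite exprn_ege1 // lerDl.
    have -> : lam * (1 + c * h) = j%:R * (k * h ^+ 2) * (1 + c * h) ^+ j.+1.
      by rewrite /lam (exprSr (1 + c * h)) !mulrA.
    rewrite -[j.+1%:R]natr1 mulrDl mulrDl lerD2l mul1r.
    by rewrite ler_peMr.
  - by rewrite h0.
  - by rewrite ZM // mulr_ge0 //= jhT // ltnW.
  - by rewrite Zsym // mulr_ge0.
  - move=> i l; have := step (j%:R * h) (j.+1%:R * h) i l.
    rewrite h_eq; apply; last exact: jhT.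
    by rewrite mulr_ge0 //= ler_wpM2r // ler_nat.
  - exact: IH (ltnW jp).
set q := bform 1%:M z z.
have q0 : 0 <= q by rewrite /q /bform mulmx1 sqnorm_ge0.
pose C := k * T ^+ 2 * expR (c * T) * q.
have C0 : 0 <= C by rewrite /C !mulr_ge0 ?sqr_ge0 ?expR_ge0.
have low p : - (C / p.+1%:R) <= bform (Z T) z z.
  have p0 : 0 < p.+1%:R :> R by rewrite ltr0n.
  have [_ /(_ z)] := euler p p.+1 (leqnn _).
  have -> : p.+1%:R * (T / p.+1%:R) = T by field; rewrite lt0r_neq0.
  rewrite bformDm -[X in _ + bform X _ _]scalemx1 bformZm -/q => low.
  suff up : p.+1%:R * (k * (T / p.+1%:R) ^+ 2) * (1 + c * (T / p.+1%:R)) ^+ p.+1 * q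
         <= C / p.+1%:R.
    by rewrite -subr_ge0 opprK (le_trans low) // lerD2l.
  have -> : p.+1%:R * (k * (T / p.+1%:R) ^+ 2) = k * T ^+ 2 / p.+1%:R.
    by field; rewrite lt0r_neq0.
  rewrite /C [leRHS]mulrAC ler_wpM2r // [leRHS]mulrAC ler_wpM2l //.
    by rewrite !mulr_ge0 ?sqr_ge0 // invr_ge0 ltW.
  have -> : c * T = p.+1%:R * (c * (T / p.+1%:R)) by field; rewrite lt0r_neq0.
  rewrite expRM_natl; apply: lerXn2r; rewrite ?nnegrE ?expR_ge0 ?expR_ge1Dx //.
  by rewrite addr_ge0 // mulr_ge0 // divr_ge0.
rewrite leNgt; apply/negP => neg.
set x := - bform (Z T) z z.
have x0 : 0 < x by rewrite oppr_gt0.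
have Cx : 0 <= C / x by rewrite divr_ge0 // ltW.
have := archi_boundP Cx; set p := Num.bound _ => Cp.
have := low p; rewrite -lerN2 opprK -/x leNgt => /negP; apply.
rewrite ltr_pdivrMr ?ltr0n // mulrC -ltr_pdivrMr //.
by rewrite (lt_trans Cp) // ltr_nat.
Qed.

End LyapunovPositivity.

(** * Averages along a trajectory *)

Lemma linear_cvg (R : realType) a b c d (L : {linear 'M[R]_(a, b) -> 'M[R]_(c, d)})
    (T : Type) (Fl : set_system T) {FF : Filter Fl} (F : T -> 'M[R]_(a, b)) X i j :
  F r @[r --> Fl] --> X -> L (F r) i j @[r --> Fl] --> L X i j.
Proof.
move=> FX.
have -> : (fun r => L (F r) i j) =
    (fun r => \sum_k \sum_l (L (delta_mx k l) i j * F r k l)).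
  by apply/funext => r; rewrite linear_coordE.
rewrite linear_coordE.
apply: (cvg_big (op := +%R) (x0 := 0)); first exact: add_continuous.
move=> k _; apply: (cvg_big (op := +%R) (x0 := 0)); first exact: add_continuous.
move=> l _; apply: cvgMr.
exact: (cvg_comp _ _ FX (@coord_continuous _ _ _ k l X)).
Qed.

Section Averages.
Variables (R : realType) (n : nat).
Local Notation mu := (@lebesgue_measure R).

Definition coord c d (L : {linear 'M[R]_n -> 'M[R]_(c, d)}) i j :
    {linear 'M[R]_n -> 'M[R]_1} :=
  (mulmxr (delta_mx j 0) \o mulmx (delta_mx 0 i)) \o L.

Definition quad (z : 'cV[R]_n) : {linear 'M[R]_n -> 'M[R]_1} :=
  mulmxr z \o mulmx z^T.

Lemma coordE c d (L : {linear 'M[R]_n -> 'M[R]_(c, d)}) i j X :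
  coord L i j X 0 0 = L X i j.
Proof.
by rewrite /= -rowE -colE !mxE.
Qed.

(** What the proof needs to know about the passage from a trajectory f to its
    integral g over D: the integral is positive and faithful. This covers both the
    integral over [0, T] and the improper integral over [0, +oo[.
    Functionals take values in 1 x 1 matrices, so that they can be composed from
    the linear maps X |-> F X and X |-> X F. *)
Definition faithful_average (D : set R) (f : R -> 'M[R]_n) (g : 'M[R]_n) : Prop :=
  forall L : {linear 'M[R]_n -> 'M[R]_1}, (forall s, D s -> 0 <= L (f s) 0 0) ->
    0 <= L g 0 0 /\ (L g 0 0 = 0 -> forall s, D s -> L (f s) 0 0 = 0).

(** Positivity of the average, applied to each coordinate of L and to its opposite. *)
Lemma faithful_average_linear D f g c d (L : {linear 'M[R]_n -> 'M[R]_(c, d)}) :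
  faithful_average D f g -> (forall s, D s -> L (f s) = 0) -> L g = 0.
Proof.
move=> avg Lf; apply/matrixP => i j; rewrite mxE; apply: le_anti.
have [|pos _] := avg (coord L i j).
  by move=> s Ds; rewrite coordE Lf // mxE.
have [|neg _] := avg (coord (-%R \o L) i j).
  by move=> s Ds; rewrite coordE /= Lf // oppr0 mxE.
by move: pos neg; rewrite !coordE /= !mxE oppr_ge0 => -> ->.
Qed.

Lemma faithful_average_psd D f g : faithful_average D f g ->
  (forall s, D s -> psd (f s)) ->
  psd g /\ forall z, bform g z z = 0 -> forall s, D s -> bform (f s) z z = 0.
Proof.
move=> avg psdf; split; last first.
  move=> z gz; apply: (avg (quad z) _).2 gz => s Ds.
  exact: (psdf s Ds).2.
split; last by move=> z; apply: (avg (quad z) _).1 => s Ds; exact: (psdf s Ds).2.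
apply/esym/eqP; rewrite -subr_eq0 -/(skew_part g); apply/eqP.
apply: (faithful_average_linear (L := @skew_part R n) avg) => s /psdf [fsym _].
by rewrite /= /skew_part fsym subrr.
Qed.

Variables (K : {linear 'M[R]_n -> 'M[R]_n}) (Z0 : 'M[R]_n) (Z : R -> 'M[R]_n).
Hypothesis sol : solves_on `[0, +oo[ (fun=> K) Z0 Z.

Lemma linear_image_lipschitz T c d (L : {linear 'M[R]_n -> 'M[R]_(c, d)}) i j :
  0 <= T -> lipschitz_upto T (fun s => L (Z s) i j).
Proof.
move=> T0; have [C C0 LC] := linear_l1_bound L.
have [k k0 lip] := linear_ode_lipschitz sol T0.
exists (C * k); first by rewrite mulr_ge0.
move=> s t st tT.
have -> : L (Z t) i j - L (Z s) i j = L (Z t - Z s) i j by rewrite linearB /= !mxE.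
apply: le_trans (le_l1 _ _ _) _; apply: le_trans (LC _) _.
by rewrite -mulrA ler_wpM2l // lip.
Qed.

Lemma linear_ode_trajectory_integrable T : 0 <= T -> mx_integrable `[0, T] Z.
Proof.
move=> T0 i j; apply: (lipschitz_upto_integrable (f := fun s => Z s i j)).
exact: (linear_image_lipschitz idfun i j T0).
Qed.

Lemma linear_of_integral t (L : {linear 'M[R]_n -> 'M[R]_1}) : 0 <= t ->
  L (mx_integral `[0, t] Z) 0 0 = \int[mu]_(s in `[0, t]) L (Z s) 0 0.
Proof.
move=> t0; have Zint := linear_ode_trajectory_integrable t0.
by rewrite (mx_integral_linear L (measurable_itv _) Zint).2 mxE.
Qed.

(** The set of times is half-open because strictness is obtained by expanding to
    the right; the end point does not contribute to the integral. *)
Lemma finite_average (T : R) : 0 < T ->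
  faithful_average [set s | 0 <= s < T] Z (mx_integral `[0, T] Z).
Proof.
move=> T_gt0 L Lpos; have T0 := ltW T_gt0.
have lip := linear_image_lipschitz L 0 0 T0.
rewrite linear_of_integral //; split; last first.
  by move=> I0; apply: (lipschitz_upto_integral_eq0 lip) => //; rewrite I0.
rewrite -Rintegral_itv_bndo_bndc.
  by apply: Rintegral_ge0 => s /=; rewrite in_itv; exact: Lpos.
apply: integrableS (lipschitz_upto_integrable lip) => //.
by apply: subset_itvl; rewrite bnd_simp.
Qed.

(** A nonnegative functional of Z has nondecreasing integrals over [0, t], all
    bounded by their limit. If the limit is 0, they all vanish, and the argument
    on a bounded interval applies. *)
Lemma infinite_average (G : 'M[R]_n) :
  mx_integral `[0, t] Z @[t --> +oo] --> G ->
  faithful_average [set s | 0 <= s] Z G.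
Proof.
move=> GE L Lpos.
have lim : L (mx_integral `[0, t] Z) 0 0 @[t --> +oo] --> L G 0 0 by exact: linear_cvg GE.
have mono s t : 0 <= s <= t -> L (mx_integral `[0, s] Z) 0 0 <= L (mx_integral `[0, t] Z) 0 0.
  move=> /[dup] st /andP[s0 le_st]; have t0 := le_trans s0 le_st.
  rewrite !linear_of_integral // -subr_ge0 Rintegral_slice //.
    apply: Rintegral_ge0 => r; rewrite /= in_itv /= => /andP[sr _].
    by apply: Lpos; exact: le_trans (ltW sr).
  exact: lipschitz_upto_integrable (linear_image_lipschitz L 0 0 t0).
have below t : 0 <= t -> L (mx_integral `[0, t] Z) 0 0 <= L G 0 0.
  move=> t0; apply: (cvgr_to_ge lim).
  near=> s; apply: mono; rewrite t0 /=; near: s.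
  by apply: nbhs_pinfty_ge; exact: num_real.
split.
  apply: le_trans (below 0 (lexx _)); rewrite linear_of_integral //.
  by rewrite set_itv1 Rintegral_set1.
move=> G0 s s0; have T0 : 0 <= s + 1 by rewrite addr_ge0.
apply: (lipschitz_upto_integral_eq0 (linear_image_lipschitz L 0 0 T0)).
- by move=> r /andP[r0 _]; exact: Lpos.
- by rewrite -linear_of_integral // -[leRHS]G0 below.
- by apply/andP; split; [exact: s0|rewrite ltrDl ltr01].
Unshelve. all: by end_near. Qed.

End Averages.

(** * The kernel of the Gramian *)

Section Series.
Variables (R : realType) (n : nat) (G : nat -> 'M[R]_n) (P : 'M[R]_n).
Hypothesis sumP : (fun r => \sum_(1 <= i < r) G i) @ \oo --> P.

Lemma series_linear_eq0 c d (L : {linear 'M[R]_n -> 'M[R]_(c, d)}) :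
  (forall i, (1 <= i)%N -> L (G i) = 0) -> L P = 0.
Proof.
move=> LG; apply/matrixP => i j.
have lim : L (\sum_(1 <= k < r) G k) i j @[r --> \oo] --> L P i j by exact: linear_cvg sumP.
have E : (fun r => L (\sum_(1 <= k < r) G k) i j) = cst 0.
  apply/funext => r; rewrite linear_sum big_nat big1 ?mxE // => k /andP[k1 _].
  exact: LG.
move: lim; rewrite E => lim; rewrite mxE.
exact: (cvg_unique _ lim (cvg_cst 0)).
Qed.

Lemma series_psd_sym : (forall i, (1 <= i)%N -> psd (G i)) -> P^T = P.
Proof.
move=> psdG; apply/esym/eqP; rewrite -subr_eq0 -/(skew_part P); apply/eqP.
apply: series_linear_eq0 => i /psdG [Gsym _].
by rewrite /= /skew_part Gsym subrr.
Qed.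

(** In a convergent series of nonnegative reals every term is at most the sum. *)
Lemma series_psd_bform_eq0 z : (forall i, (1 <= i)%N -> psd (G i)) ->
  bform P z z = 0 -> forall i, (1 <= i)%N -> bform (G i) z z = 0.
Proof.
move=> psdG Pz i i1; apply: le_anti; rewrite (psdG i i1).2 andbT.
have lim : quad z (\sum_(1 <= k < r) G k) 0 0 @[r --> \oo] --> quad z P 0 0.
  exact: linear_cvg sumP.
rewrite -Pz; apply: (cvgr_to_ge lim).
exists i.+1 => // r /= ir; rewrite mulmx_sumr mulmx_suml summxE.
rewrite (bigD1_seq i) ?mem_index_iota ?i1 ?iota_uniq //= lerDl.
rewrite big_seq_cond sumr_ge0 // => k; rewrite mem_index_iota => /andP[/andP[k1 _] _].
exact: (psdG k k1).2.
Qed.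

End Series.

(** The orthogonal complement of the range of a symmetric P is its kernel, and that
    of the range of P *t P is the kernel of P *t P. So this says, by duality, that
    the range of P contains the columns of B and is invariant under A, the blocks
    of N and the bilinear map given by H. *)
Definition invariant_kernel (R : realType) (n m : nat) (A : 'M[R]_n)
    (B : 'M[R]_(n, m)) (N : 'M[R]_(n, m * n)) (H : 'M[R]_(n, n * n))
    (P : 'M[R]_n) : Prop :=
  P^T = P /\ forall z : 'cV[R]_n, P *m z = 0 ->
    [/\ P *m (A^T *m z) = 0, B^T *m z = 0,
        ((1%:M : 'M[R]_m) *t P) *m (N^T *m z) = 0 & (P *t P) *m (H^T *m z) = 0].

Section KernelInvariance.
Variables (R : realType) (n m : nat).
Variables (A : 'M[R]_n) (B : 'M[R]_(n, m)).
Variables (N : 'M[R]_(n, m * n)) (H : 'M[R]_(n, n * n)).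
Variables (Z : nat -> R -> 'M[R]_n) (G : nat -> 'M[R]_n) (P : 'M[R]_n).
Variable D : set R.
Hypothesis terms : gramian_terms A B N H G Z.
Hypothesis D_ge0 : forall s, D s -> 0 <= s.
Hypothesis D0 : D 0.
Hypothesis D_right : forall s, D s -> exists2 t, s < t & forall r, s <= r <= t -> D r.
Hypothesis avg : forall i, (1 <= i)%N -> faithful_average D (Z i) (G i).
Hypothesis sumP : (fun r => \sum_(1 <= i < r) G i) @ \oo --> P.

Lemma gramian_init_psd i : (1 <= i)%N ->
  (forall k, (1 <= k < i)%N -> psd (G k)) -> psd (gramian_init B H G i).
Proof.
move=> i1 psdG; rewrite /gramian_init; case: ifP => _; first exact: psd_gram.
apply: psd_congr; rewrite big_nat; apply: psd_sum => k /andP[k1 ki].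
apply: psd_tens; apply: psdG; first by rewrite k1.
by rewrite subn_gt0 ki /= ltn_subrL k1.
Qed.

(** The initial value of the i-th term involves G k for k < i only, hence strong
    induction on i. *)
Lemma gramian_term_psd i : (1 <= i)%N ->
  (forall s, 0 <= s -> psd (Z i s)) /\ psd (G i).
Proof.
elim/ltn_ind: i => i IH i1.
have psdZ s : 0 <= s -> psd (Z i s).
  apply: (lyap_solution_psd _ (terms i1)); apply: gramian_init_psd => // k /andP[k1 ki].
  exact: (IH k ki k1).2.
split=> //; apply: (faithful_average_psd (avg i1) _).1 => s /D_ge0.
exact: psdZ.
Qed.

Let psdZ i s : (1 <= i)%N -> 0 <= s -> psd (Z i s).
Proof. by move=> i1; exact: (gramian_term_psd i1).1. Qed.

Let psdG i : (1 <= i)%N -> psd (G i).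
Proof. by move=> i1; exact: (gramian_term_psd i1).2. Qed.

Lemma gramian_sym : P^T = P.
Proof. exact: series_psd_sym sumP psdG. Qed.

(** This turns out to describe the kernel of P: kernel_killed is one inclusion, and
    linear_gramian_eq0 yields the other. *)
Definition killed (z : 'cV[R]_n) : Prop :=
  forall i s, (1 <= i)%N -> D s -> Z i s *m z = 0.

(** P z = 0 gives z^T P z = 0, a sum of nonnegative terms z^T G_i z. Each of them
    vanishes, and so does the nonnegative continuous function z^T Z_i(s) z of
    which it is the integral. *)
Lemma kernel_killed z : P *m z = 0 -> killed z.
Proof.
move=> Pz i s i1 Ds; apply: psd_ker; first exact: psdZ (D_ge0 Ds).
apply: (faithful_average_psd (avg i1) _).2 (Ds) => [r /D_ge0|]; first exact: psdZ.
apply: (series_psd_bform_eq0 sumP psdG) => //.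
by rewrite /bform -mulmxA Pz mulmx0 mxE.
Qed.

Lemma linear_gramian_eq0 c d (L : {linear 'M[R]_n -> 'M[R]_(c, d)}) :
  (forall i s, (1 <= i)%N -> D s -> L (Z i s) = 0) -> L P = 0.
Proof.
move=> LZ; apply: (series_linear_eq0 sumP) => i i1.
by apply: (faithful_average_linear (avg i1)) => s; exact: LZ.
Qed.

(** Z_i(s) z and Z_i(s + h) z both vanish, so the expansion of Z_i at s, applied to
    z, leaves h L(Z_i(s)) z = O(h^2) for the Lyapunov operator L. *)
Lemma killed_lyap z i s : killed z -> (1 <= i)%N -> D s ->
  lyap A N (Z i s) *m z = 0.
Proof.
move=> kz i1 Ds; have s0 := D_ge0 Ds.
have [t st Dr] := D_right Ds; have t0 := le_trans s0 (ltW st).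
have [K K0 step] := linear_ode_step (L := lyap A N) (terms i1) t0.
pose w := lyap A N (Z i s) *m z.
have small h k : 0 < h <= t - s -> `|w k 0| <= K * l1 z * h.
  move=> /andP[h0 ht].
  have sh : s <= s + h <= t by rewrite lerDl ltW //= -lerBrDl.
  pose E := Z i (s + h) - Z i s - h *: lyap A N (Z i s).
  have wE : E *m z = - (h *: w).
    rewrite /E !mulmxBl (kz _ _ i1 (Dr _ sh)) (kz _ _ i1 Ds) subr0 sub0r.
    by rewrite -scalemxAl.
  have : `|(E *m z) k 0| <= K * h ^+ 2 * l1 z.
    rewrite mxE (le_trans (ler_norm_sum _ _ _)) // /l1 mulr_sumr.
    apply: ler_sum => l _; rewrite normrM big_ord1 ler_wpM2r //.
    have sh_s : s + h - s = h by rewrite addrAC subrr add0r.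
    have := step s (s + h) k l; rewrite sh_s s0 lerDl (ltW h0).
    case/andP: sh => _ -> /(_ isT isT); rewrite /E.
    by rewrite !mxE.
  rewrite wE !mxE normrN normrM (gtr0_norm h0) => le1.
  by rewrite -(ler_pM2l h0) (le_trans le1) // expr2; lra.
apply/colP => k; rewrite [RHS]mxE -/w; apply/eqP; rewrite -normr_le0.
apply: (@small_multiple_le0 _ _ (K * l1 z) (t - s)).
- by rewrite subr_gt0.
- by rewrite mulr_ge0 ?l1_ge0.
- by move=> h /andP[h0 ht]; rewrite small // h0 ltW.
Qed.

(** In z^T L(Z) z = 0 the terms with A vanish because Z z = 0. What remains is the
    value of the positive form 1%:M *t Z at N^T z. *)
Lemma killed_N z i s : killed z -> (1 <= i)%N -> D s ->
  ((1%:M : 'M[R]_m) *t Z i s) *m (N^T *m z) = 0.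
Proof.
move=> kz i1 Ds; have psdZis := psdZ i1 (D_ge0 Ds).
apply: psd_ker; first exact: psd_tens (psd_scalar m ler01) psdZis.
have : z^T *m (lyap A N (Z i s) *m z) = 0 by rewrite killed_lyap // mulmx0.
rewrite /lyap !mulmxDl !mulmxDr => /matrixP /(_ 0 0).
have zZ : z^T *m Z i s = 0.
  by apply: trmx_inj; rewrite trmx_mul trmxK psdZis.1 kz // trmx0.
rewrite -!mulmxA kz // !mulmx0 !mulmxA zZ !mul0mx !add0r.
by rewrite /bform trmx_mul trmxK !mulmxA => ->; rewrite mxE.
Qed.

(** Of the three terms of L(Z) z = 0 only Z A^T z is left. *)
Lemma killed_A z i s : killed z -> (1 <= i)%N -> D s ->
  Z i s *m (A^T *m z) = 0.
Proof.
move=> kz i1 Ds; have := killed_lyap kz i1 Ds.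
rewrite /lyap !mulmxDl -!mulmxA kz // mulmx0 add0r.
by rewrite killed_N // mulmx0 addr0.
Qed.

Lemma kernel_A (z : 'cV[R]_n) : P *m z = 0 -> P *m (A^T *m z) = 0.
Proof.
move=> /kernel_killed kz.
apply: (linear_gramian_eq0 (L := mulmxr (A^T *m z))) => i s i1 Ds.
exact: killed_A.
Qed.

Lemma kernel_N (z : 'cV[R]_n) : P *m z = 0 -> ((1%:M : 'M[R]_m) *t P) *m (N^T *m z) = 0.
Proof.
move=> /kernel_killed kz.
apply: (linear_gramian_eq0 (L := mulmxr (N^T *m z) \o @tensl R m m n n 1%:M)) => i s i1 Ds.
exact: killed_N.
Qed.

(** The initial value of Z_1 is B B^T, and it annihilates z. *)
Lemma kernel_B (z : 'cV[R]_n) : P *m z = 0 -> B^T *m z = 0.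
Proof.
move=> /kernel_killed /(_ 1%N 0 isT D0).
rewrite (linear_ode_init (L := lyap A N) (terms (ltnSn 0))) /gramian_init eqxx.
move=> BBz; apply: sqnorm_eq0.
by rewrite trmx_mul trmxK mulmxA -(mulmxA _ B) -mulmxA BBz mulmx0 mxE.
Qed.

(** The initial value of the term of index k + l annihilates z. It contains the
    positive terms H (G_j *t G_(k+l-j)) H^T, so each of these has value 0 at z; the
    term j = k is the one in question. *)
Lemma kernel_G_tens (z : 'cV[R]_n) k l : P *m z = 0 -> (1 <= k)%N -> (1 <= l)%N ->
  (G k *t G l) *m (H^T *m z) = 0.
Proof.
move=> /kernel_killed kz k1 l1; have kl1 : (1 <= k + l)%N by rewrite addn_gt0 k1.
have := kz _ 0 kl1 D0.
rewrite (linear_ode_init (L := lyap A N) (terms kl1)) /gramian_init ifN; last first.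
  by rewrite gtn_eqF // -(addn1 1) leq_add.
set S := \sum_(_ <= _ < _) _ => HSHz.
have Sy : bform S (H^T *m z) (H^T *m z) = 0.
  by rewrite -bform_congr /bform -mulmxA HSHz mulmx0 mxE.
apply: psd_ker; first exact: psd_tens (psdG k1) (psdG l1).
have psdT j : (1 <= j < k + l)%N -> psd (G j *t G (k + l - j)%N).
  move=> /andP[j1 jkl]; apply: psd_tens; apply: psdG => //.
  by rewrite subn_gt0.
apply: le_anti; rewrite -{1}Sy (psd_tens (psdG k1) (psdG l1)).2 andbT.
rewrite /S (bigD1_seq k) ?mem_index_iota ?iota_uniq //=; last first.
  by rewrite k1 -addn1 leq_add2l.
rewrite addKn bformDm lerDl big_seq_cond.
suff : psd (\sum_(i <- index_iota 1 (k + l) | (i \in index_iota 1 (k + l)) && (i != k))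
              G i *t G (k + l - i)%N) by case.
by apply: psd_sum => j; rewrite mem_index_iota => /andP[/psdT].
Qed.

(** The series for P is inserted into one factor of the Kronecker product at a time. *)
Lemma kernel_H (z : 'cV[R]_n) : P *m z = 0 -> (P *t P) *m (H^T *m z) = 0.
Proof.
move=> Pz.
apply: (series_linear_eq0 sumP (L := mulmxr (H^T *m z) \o @tensl R n n n n P)) => l l1 /=.
apply: (series_linear_eq0 sumP (L := mulmxr (H^T *m z) \o @tensr R n n n n (G l))) => k k1 /=.
exact: kernel_G_tens.
Qed.

Lemma gramian_invariant_kernel : invariant_kernel A B N H P.
Proof.
split=> [|z Pz]; first exact: gramian_sym.
by split; [exact: kernel_A|exact: kernel_B|exact: kernel_N|exact: kernel_H].
Qed.

End KernelInvariance.

Section GramianKernel.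
Variables (R : realType) (n m : nat).
Variables (A : 'M[R]_n) (B : 'M[R]_(n, m)).
Variables (N : 'M[R]_(n, m * n)) (H : 'M[R]_(n, n * n)).

Lemma gramian_finite_kernel T P : 0 < T ->
  is_gramian_finite A B N H T P -> invariant_kernel A B N H P.
Proof.
move=> T0 [Z [terms sumP]].
pose D := [set s : R | 0 <= s < T].
have D_ge0 s : D s -> 0 <= s by case/andP.
have D0 : D 0 by rewrite /D /= lexx.
have D_right s : D s -> exists2 t, s < t & forall r, s <= r <= t -> D r.
  move=> /andP[s0 sT]; exists ((s + T) / 2) => [|r /andP[sr rt]]; first by lra.
  by rewrite /D /= (le_trans s0 sr) (le_lt_trans rt) //; lra.
have avg i : (1 <= i)%N -> faithful_average D (Z i) (mx_integral `[0, T] (Z i)).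
  by move=> i1; exact: (finite_average (K := lyap A N) (terms i i1)).
exact: gramian_invariant_kernel terms D_ge0 D0 D_right avg sumP.
Qed.

Lemma gramian_infinite_kernel P :
  is_gramian_infinite A B N H P -> invariant_kernel A B N H P.
Proof.
move=> [Z [G [terms limG sumP]]].
pose D := [set s : R | 0 <= s].
have D_ge0 s : D s -> 0 <= s by [].
have D0 : D 0 by rewrite /D /= lexx.
have D_right s : D s -> exists2 t, s < t & forall r, s <= r <= t -> D r.
  move=> s0; exists (s + 1) => [|r /andP[sr _]]; first by rewrite ltrDl.
  exact: le_trans sr.
have avg i : (1 <= i)%N -> faithful_average D (Z i) (G i).
  by move=> i1; exact: (infinite_average (K := lyap A N) (terms i i1) (limG i i1)).
exact: gramian_invariant_kernel terms D_ge0 D0 D_right avg sumP.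
Qed.

Lemma kernel_columns a b c (P : 'M[R]_(a, b)) d (X : 'M[R]_(d, b)) (Q : 'M[R]_(b, c)) :
  (forall z : 'cV[R]_b, P *m z = 0 -> X *m z = 0) -> P *m Q = 0 -> X *m Q = 0.
Proof.
move=> PX PQ; apply/matrixP => i j.
have : X *m (Q *m (delta_mx j 0 : 'cV[R]_c)) = 0 by rewrite PX // mulmxA PQ mul0mx.
by rewrite mulmxA -colE => /colP /(_ i); rewrite mxE [RHS]mxE => ->; rewrite mxE.
Qed.

(** The transpose of invariant_kernel, with Q mapping into the kernel of P. *)
Lemma range_invariant P Q : invariant_kernel A B N H P -> Q^T = Q -> P *m Q = 0 ->
  [/\ Q *m A *m P = 0, Q *m B = 0, Q *m N *m ((1%:M : 'M[R]_m) *t P) = 0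
    & Q *m H *m (P *t P) = 0].
Proof.
move=> [Psym ker] Qsym PQ; split; apply: trmx_inj;
  rewrite !trmx_mul ?trmx_tens ?trmx1 ?Psym Qsym trmx0.
- by rewrite mulmxA; apply: kernel_columns PQ => z /ker [PA _ _ _]; rewrite -mulmxA.
- by apply: kernel_columns PQ => z /ker [].
- by rewrite mulmxA; apply: kernel_columns PQ => z /ker [_ _ PN _]; rewrite -mulmxA.
- by rewrite mulmxA; apply: kernel_columns PQ => z /ker [_ _ _ PH]; rewrite -mulmxA.
Qed.

End GramianKernel.

(** * The reduced system *)

(** |v| <= 1 + v^2, and constants are integrable on a bounded interval. *)
Lemma square_integrable_integrable (R : realType) k l (T : R)
    (v : R -> 'M[R]_(k, l)) : square_integrable_on `[0, T] v ->
  mx_integrable `[0, T] v.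
Proof.
move=> v2 i j; have [vmeas v2int] := v2 i j.
have mD : measurable (`[0, T] : set (measurableTypeR R)) by exact: measurable_itv.
have c1 : (@lebesgue_measure R).-integrable `[0, T] (EFin \o fun=> 1) by exact: integrable_cst_itv.
apply: le_integrable (integrableD mD c1 v2int) => //; first exact/measurable_EFinP.
move=> s _ /=; rewrite lee_fin.
have := sqr_ge0 (`|v s i j| - 1); rewrite sqrrB real_normK ?num_real //.
rewrite [X in _ -> _ <= X]ger0_norm; last by rewrite addr_ge0 // sqr_ge0.
by have := normr_ge0 (v s i j); lra.
Qed.

Section Reduction.
Variables (R : realType) (n m r : nat) (T : R).
Local Notation mu := (@lebesgue_measure R).
Variables (A : 'M[R]_n) (B : 'M[R]_(n, m)).
Variables (N : 'M[R]_(n, m * n)) (H : 'M[R]_(n, n * n)).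
Variables (u v : R -> 'cV[R]_m) (x : R -> 'cV[R]_n) (V : 'M[R]_(n, r)).
Hypothesis T0 : 0 <= T.
Hypothesis x_sol : solves_on `[0, T] (system_rhs A B N H u v) 0 x.

Let Q := 1%:M - V *m V^T.
Hypothesis QA : Q *m A *m V = 0.
Hypothesis QB : Q *m B = 0.
Hypothesis QN : Q *m N *m ((1%:M : 'M[R]_m) *t V) = 0.
Hypothesis QH : Q *m H *m (V *t V) = 0.

Lemma solution_in0T t : 0 <= t <= T ->
  mx_integrable `[0, t] (fun s => system_rhs A B N H u v s (x s)) /\
  x t = mx_integral `[0, t] (fun s => system_rhs A B N H u v s (x s)).
Proof.
move=> tT; have [| xint ->] := x_sol (t := t); first by rewrite /= in_itv.
by rewrite add0r.
Qed.

Lemma solution_bounded : exists2 M, 0 <= M & forall t, 0 <= t <= T -> l1 (x t) <= M.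
Proof.
have [|Fint _] := @solution_in0T T; first by rewrite T0 lexx.
have [F1int _] := l1_integral_le Fint.
exists (\int[mu]_(s in `[0, T]) l1 (system_rhs A B N H u v s (x s))) => [|t tT].
  by rewrite Rintegral_ge0 // => s _; exact: l1_ge0.
have [Fint' ->] := solution_in0T tT.
rewrite (le_trans (l1_integral_le Fint').2) //.
rewrite -subr_ge0 Rintegral_slice //.
by apply: Rintegral_ge0 => s _; exact: l1_ge0.
Qed.

(** Only terms with a factor z = Q y survive the projection: those built from the
    component xi of y in the range of V vanish by invariance, and so does B u. *)
Lemma complement_rhs s (y : 'cV[R]_n) :
  let z := Q *m y in let xi := V *m V^T *m y in
  Q *m system_rhs A B N H u v s y =
  Q *m A *m z + Q *m N *m (v s *t z) + Q *m H *m (z *t y + xi *t z).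
Proof.
move=> z xi; have yE : y = xi + z by rewrite /xi /z mulmxBl mul1mx addrC subrK.
have QAxi : Q *m A *m xi = 0 by rewrite /xi -(mulmxA V) (mulmxA (Q *m A)) QA mul0mx.
have QNxi : Q *m N *m (v s *t xi) = 0.
  have -> : v s *t xi = ((1%:M : 'M[R]_m) *t V) *m (v s *t (V^T *m y)).
    by rewrite tensmx_mul mul1mx mulmxA.
  by rewrite mulmxA QN mul0mx.
have QHxi : Q *m H *m (xi *t xi) = 0.
  have -> : xi *t xi = (V *t V) *m ((V^T *m y) *t (V^T *m y)).
    by rewrite tensmx_mul mulmxA.
  by rewrite mulmxA QH mul0mx.
have vy : v s *t y = v s *t xi + v s *t z.
  by rewrite {1}yE; apply/matrixP => i j; rewrite !mxE mulrDr.
have yy : y *t y = xi *t xi + (z *t y + xi *t z).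
  have tens_sqr (a b : 'cV[R]_n) : (a + b) *t (a + b) = a *t a + (b *t (a + b) + a *t b).
    by apply/matrixP => i j; rewrite !mxE; ring.
  by have := tens_sqr xi z; rewrite -yE.
have QAy : Q *m A *m y = Q *m A *m z by rewrite {1}yE mulmxDr QAxi add0r.
rewrite /system_rhs !(mulmxDr Q) !(mulmxA Q) QB mul0mx addr0 QAy vy yy.
by rewrite (mulmxDr _ _ (v s *t z)) (mulmxDr _ (xi *t xi)) QNxi QHxi !add0r.
Qed.

Hypothesis v_int : mx_integrable `[0, T] v.

(** By complement_rhs and the boundedness of x, the derivative of Q x is bounded by
    g(s) |Q x(s)|, where g(s) is affine in |v(s)| and hence integrable. *)
Lemma solution_in_range t : 0 <= t <= T -> x t = V *m (V^T *m x t).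
Proof.
have [M M0 xM] := solution_bounded.
pose F s := Q *m system_rhs A B N H u v s (x s).
pose g s := l1 (Q *m A) + l1 (Q *m H) * (M + l1 (V *m V^T) * M) + l1 (Q *m N) * l1 (v s).
have rhs_int t' : 0 <= t' <= T ->
    mx_integrable `[0, t'] F /\ Q *m x t' = mx_integral `[0, t'] F.
  move=> /solution_in0T [Fint ->].
  exact: (mx_integral_linear (mulmx Q) (measurable_itv _) Fint).
have g_int : mu.-integrable `[0, T] (EFin \o g).
  have mD : measurable (`[0, T] : set (measurableTypeR R)) by exact: measurable_itv.
  have c1 := integrable_cst_itv
    (l1 (Q *m A) + l1 (Q *m H) * (M + l1 (V *m V^T) * M)) 0 T true false.
  have c2 := integrable_scale (l1 (Q *m N)) mD (l1_integral_le v_int).1.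
  apply: (eq_integrable mD) (integrableD mD c1 c2).
  by move=> s _ /=; rewrite -EFinD.
have g0 s : 0 <= s <= T -> 0 <= g s.
  by move=> _; rewrite /g !addr_ge0 ?mulr_ge0 ?addr_ge0 ?mulr_ge0 ?l1_ge0.
have Fle s : 0 <= s <= T -> l1 (F s) <= g s * l1 (Q *m x s).
  move=> sT; rewrite /F complement_rhs.
  set z := Q *m x s; set xi := V *m V^T *m x s.
  have z0 := l1_ge0 z; have x_le := xM s sT.
  have b1 : l1 (Q *m A *m z) <= l1 (Q *m A) * l1 z by exact: l1_mul.
  have b2 : l1 (Q *m N *m (v s *t z)) <= l1 (Q *m N) * l1 (v s) * l1 z.
    by rewrite (le_trans (l1_mul _ _)) // l1_tens mulrA.
  have b3 : l1 (Q *m H *m (z *t x s + xi *t z)) <=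
      l1 (Q *m H) * (M + l1 (V *m V^T) * M) * l1 z.
    rewrite (le_trans (l1_mul _ _)) // -mulrA ler_wpM2l ?l1_ge0 //.
    rewrite (le_trans (ler_l1D _ _)) // !l1_tens mulrDl lerD //.
      by rewrite mulrC ler_wpM2r.
    rewrite ler_wpM2r // (le_trans (l1_mul _ _)) // ler_wpM2l ?l1_ge0 //.
  have := ler_l1D (Q *m A *m z + Q *m N *m (v s *t z)) (Q *m H *m (z *t x s + xi *t z)).
  have := ler_l1D (Q *m A *m z) (Q *m N *m (v s *t z)).
  rewrite /g !mulrDl; move: b1 b2 b3; rewrite -!mulrA mulrDl.
  by lra.
move=> tT; have := gronwall_mx_zero T0 g_int _ g0 Fle (fun t' tT' => (rhs_int t' tT').2) tT.
rewrite mulmxBl mul1mx mulmxA => H0; apply/eqP; rewrite -subr_eq0; apply/eqP.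
apply: H0; apply: (rhs_int T _).1; by rewrite T0 lexx.
Qed.

(** Apply V^T to the equation and substitute V (V^T x) for x on the right. *)
Lemma reduced_solution :
  solves_on `[0, T] (system_rhs (V^T *m A *m V) (V^T *m B)
    (V^T *m N *m ((1%:M : 'M[R]_m) *t V)) (V^T *m H *m (V *t V)) u v) 0
    (fun t => V^T *m x t).
Proof.
move=> t; rewrite /= in_itv /= => /[dup] tT /andP[t0 le_tT].
have [Fint xE] := solution_in0T tT.
have rhsE s : 0 <= s <= t -> V^T *m system_rhs A B N H u v s (x s) =
    system_rhs (V^T *m A *m V) (V^T *m B) (V^T *m N *m ((1%:M : 'M[R]_m) *t V))
      (V^T *m H *m (V *t V)) u v s (V^T *m x s).
  move=> /andP[s0 st]; have sT : 0 <= s <= T by rewrite s0 (le_trans st).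
  have xs := solution_in_range sT; rewrite {1}xs; set y := V^T *m x s.
  rewrite /system_rhs !mulmxDr -!mulmxA tensmx_mul mul1mx tensmx_mul.
  by [].
have [VFint VFE] := mx_integral_linear (mulmx V^T) (measurable_itv _) Fint.
have mD : measurable (`[0, t] : set (measurableTypeR R)) by exact: measurable_itv.
split.
  move=> i j; apply: (eq_integrable mD) (VFint i j) => s.
  by rewrite inE /= in_itv /= => st; rewrite rhsE.
rewrite {1}xE VFE add0r; apply/matrixP => i j; rewrite !mxE.
by apply: eq_Rintegral => s; rewrite inE /= in_itv /= => st; rewrite rhsE.
Qed.
End Reduction.

Theorem proposition3p6 (R : realType) (n m p nh : nat) (T : R) (T_gt0 : 0 < T)
    (A : 'M[R]_n) (B : 'M[R]_(n, m)) (C : 'M[R]_(p, n))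
    (N : 'M[R]_(n, m * n)) (H : 'M[R]_(n, n * n))
    (u v : R -> 'cV[R]_m)
    (u_L2 : square_integrable_on `[0, T] u)
    (v_L2 : square_integrable_on `[0, T] v)
    (P : 'M[R]_n)
    (P_gramian : is_gramian_finite A B N H T P \/ is_gramian_infinite A B N H P)
    (x : R -> 'cV[R]_n) (y : R -> 'cV[R]_p)
    (x_sol : solves_on `[0, T] (system_rhs A B N H u v) 0 x)
    (y_out : forall t, t \in `[0, T] -> y t = C *m x t)
    (e : 'I_nh -> 'cV[R]_n) (e_eig : orthonormal_eigenvectors P e) :
  let V : 'M[R]_(n, nh) := mx_of_cols e in
  let xh : R -> 'cV[R]_nh := fun t => \col_i dotv (x t) (e i) in
  let Ah : 'M[R]_nh := V^T *m A *m V in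
  let Bh : 'M[R]_(nh, m) := V^T *m B in
  let Nh : 'M[R]_(nh, m * nh) := V^T *m N *m ((1%:M : 'M[R]_m) *t V) in
  let Hh : 'M[R]_(nh, nh * nh) := V^T *m H *m (V *t V) in
  let Ch : 'M[R]_(p, nh) := C *m V in
  [/\ forall t, t \in `[0, T] -> x t = V *m xh t,
      solves_on `[0, T] (system_rhs Ah Bh Nh Hh u v) 0 xh
    & forall t, t \in `[0, T] -> y t = Ch *m xh t].
Proof.
move=> V xh Ah Bh Nh Hh Ch.
have T0 := ltW T_gt0.
have xhE : xh = fun t => V^T *m x t by apply/funext => t; rewrite /xh dotv_colsE.
have kerP : invariant_kernel A B N H P.
  by case: P_gramian; [exact: gramian_finite_kernel|exact: gramian_infinite_kernel].
have [W VE] : exists W, V = P *m W by exact: cols_range.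
pose Q := 1%:M - V *m V^T.
have Qsym : Q^T = Q by rewrite /Q linearB /= trmx1 trmx_mul trmxK.
have [QA QB QN QH] := range_invariant kerP Qsym (cols_kernel e_eig kerP.1).
have QAV : Q *m A *m V = 0 by rewrite VE mulmxA QA mul0mx.
(* V = P W turns the relations for the range of P into relations for V. *)
have QNV : Q *m N *m ((1%:M : 'M[R]_m) *t V) = 0.
  rewrite -[1%:M]mulmx1 VE -tensmx_mul mulmxA.
  by rewrite QN mul0mx.
have QHV : Q *m H *m (V *t V) = 0 by rewrite VE -tensmx_mul mulmxA QH mul0mx.
have v_int := square_integrable_integrable v_L2.
have xV t : t \in `[0, T] -> x t = V *m xh t.
  rewrite in_itv /= xhE; exact: (solution_in_range T0 x_sol).
split=> // [|t tT].
  by rewrite xhE; exact: (reduced_solution T0 x_sol).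
by rewrite y_out // xV // mulmxA.
Qed.
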